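(* Let $\Phi$ be a locally absolutely square-integrable invariant random complex measure on $\mathbb R^d$ and let $K$ be an invariant transport kernel. Assume that at least one of the following two conditions holds: (a) for some strongly log-dominating function $\rho$, the invariant random measure $$\Big(\int\sqrt{\|x\|^{d}\rho(\|x\|)+1}\;|K^\ast|(y,dx)\Big)\,|\Phi|(dy)$$ is locally square-integrable; (b) $K$ has uniformly bounded total variation, $K$ and $\Phi$ are independent, and $\mathbb E\big[\int\|x\|^{d}\,|K_0|(dx)\big]<\infty$. Then $K\Phi$ is locally absolutely square-integrable.
   Context: $d\in\mathbb N=\{1,2,\dots\}$, $B_r=\{x\in\mathbb R^d:\|x\|<r\}$. $(\Omega,\mathcal A,\mathbb P)$ is a probability space with a measurable flow $\{\theta_x:x\in\mathbb R^d\}$ ($\theta_0=\mathrm{id}$, $\theta_{x+y}=\theta_x\theta_y$, $(\omega,x)\mapsto\theta_x\omega$ measurable) preserving $\mathbb P$. A random complex measure $\Phi$ is a random element of the space of complex measures on $\mathbb R^d$ of the form $\mu_1-\mu_2+i(\mu_3-\mu_4)$ with $\mu_j$ locally finite measures ($\sigma$-field generated by evaluations on bounded Borel sets); $|\Phi|$ is its total variation measure. A random measure is a nonnegative one. $\Phi$ is invariant if $\Phi(\theta_x\omega,B)=\Phi(\omega,B+x)$ for all $x,\omega$ and bounded Borel $B$, and locally absolutely square-integrable if $\mathbb E[|\Phi|(B_1)^2]<\infty$ (for nonnegative $\Phi$: locally square-integrable). A transport kernel $K$ assigns measurably to each $(\omega,x)\in\Omega\times\mathbb R^d$ a complex measure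 $K(\omega,x,\cdot)$ on $\mathbb R^d$ of finite total variation; $K_x=K(x)=K(\cdot,x,\cdot)$, $|K|(x,\cdot)=|K(x,\cdot)|$, $K^\ast(\omega,x,B)=K(\omega,x,B+x)$, and $K\Phi(B)=\int K(x,B)\,\Phi(dx)$ (well defined when $|K||\Phi|$ is locally finite). $K$ is invariant if $K(\theta_z\omega,x,B)=K(\omega,x+z,B+z)$. Uniformly bounded total variation means $|K|(\omega,x,\mathbb R^d)\le b$ for a constant $b$. When $K$ and $\Phi$ are assumed independent, $K$ is regarded as a random element of the Skorokhod space of càdlàg maps from $\mathbb R^d$ to the (metrized) space of finite complex measures. An increasing function $\rho:[0,\infty)\to[0,\infty)$ is strongly log-dominating if $\int_0^\infty\frac{1}{r\rho(r)+1}\,dr<\infty$. *)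

(* Defs.v *)
From HB Require Import structures.
From mathcomp Require Import all_boot all_order all_algebra.
From mathcomp Require Import complex.
From mathcomp Require Import all_classical all_reals all_analysis.

Set Implicit Arguments.
Unset Strict Implicit.
Unset Printing Implicit Defensive.

Import Order.TTheory GRing.Theory Num.Theory.
Import numFieldNormedType.Exports.

Local Open Scope classical_set_scope.
Local Open Scope ring_scope.

(* R^d is 'rV[R]_d with the Borel sigma-algebra of its (product) topology. *)
HB.instance Definition _ (R : realType) (d : nat) :=
  @isMeasurable.Build (sigma_display (@open 'rV[R]_d)) 'rV[R]_d
    <<s open >> (@sigma_algebra0 _ setT open) (@sigma_algebraC _ open)
    (@sigma_algebra_bigcup _ setT open).

Section Euclidean.
Context {R : realType} {d : nat}.
Implicit Types (x : 'rV[R]_d) (B : set 'rV[R]_d).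

(* The library norm on 'rV[R]_d is the sup norm; this is the Euclidean one. *)
Definition enorm x : R := Num.sqrt (\sum_i x 0 i ^+ 2).

Definition eball (r : R) : set 'rV[R]_d := [set x | enorm x < r].

Definition bounded_borel B : Prop :=
  measurable B /\ exists r : R, B `<=` eball r.

Definition translate B x : set 'rV[R]_d := [set y + x | y in B].

Definition locally_finite (mu : set 'rV[R]_d -> \bar R) : Prop :=
  forall B, bounded_borel B -> (mu B < +oo)%E.

End Euclidean.

Section ComplexMeasure.
Context {R : realType} {d : nat}.
Local Notation X := 'rV[R]_d.

(* Only the values on bounded Borel sets are meaningful: elsewhere
   mu_1 - mu_2 + i (mu_3 - mu_4) may be undefined. *)
Definition is_complex_measure (nu : set X -> R[i]) : Prop :=
  exists mu : 'I_4 -> {measure set X -> \bar R},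
    (forall j, locally_finite (mu j)) /\
    forall B, bounded_borel B ->
      nu B = ((fine (mu (inord 0) B) - fine (mu (inord 1) B)) +i*
              (fine (mu (inord 2) B) - fine (mu (inord 3) B)))%C.

Record cmeasure := CMeasure {
  cmeasure_val :> set X -> R[i];
  cmeasureP : is_complex_measure cmeasure_val
}.

(* Total variation measure.  The supremum runs over finite disjoint families
   of bounded Borel subsets of B, so that it makes sense for unbounded B too. *)
Definition tv (nu : set X -> R[i]) (B : set X) : \bar R :=
  ereal_sup [set s | exists (n : nat) (A : 'I_n -> set X),
    [/\ forall i, bounded_borel (A i) /\ A i `<=` B,
        trivIset setT A
      & s = (\sum_(i < n) ComplexField.Normc.normc (nu (A i)))%:E]].

Record fcmeasure := FCMeasure {
  fcmeasure_val :> cmeasure;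
  fcmeasureP : (tv fcmeasure_val setT < +oo)%E
}.

(* The sigma-field generated by the evaluations nu |-> nu B in C = R^2. *)
Definition eval_sigma : set (set cmeasure) :=
  <<s [set S | exists (B : set X) (U : set (R * R)),
        [/\ bounded_borel B, measurable U
          & S = [set nu : cmeasure |
                  U (complex.Re (nu B), complex.Im (nu B))]]] >>.

(* Jordan decomposition of a locally finite signed measure, through its upper
   and lower variations. *)
Definition jordan_plus (s : set X -> R) (B : set X) : \bar R :=
  ereal_sup [set (s A)%:E | A in [set A | bounded_borel A /\ A `<=` B]].

Definition jordan_minus (s : set X -> R) (B : set X) : \bar R :=
  ereal_sup [set (- s A)%:E | A in [set A | bounded_borel A /\ A `<=` B]].

Definition signed_integral (s : set X -> R) (f : X -> R) : R :=
  fine (\int[jordan_plus s]_x (f x)%:E)%E -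
  fine (\int[jordan_minus s]_x (f x)%:E)%E.

Definition cintegral (nu : set X -> R[i]) (f : X -> R[i]) : R[i] :=
  let nur B := complex.Re (nu B) in
  let nui B := complex.Im (nu B) in
  let fr x := complex.Re (f x) in
  let fi x := complex.Im (f x) in
  ((signed_integral nur fr - signed_integral nui fi) +i*
   (signed_integral nur fi + signed_integral nui fr))%C.

End ComplexMeasure.
Arguments cmeasure : clear implicits.
Arguments fcmeasure : clear implicits.
Arguments eval_sigma : clear implicits.

Section Random.
Context {dT : measure_display} {T : measurableType dT} {R : realType} {d : nat}.
Local Notation X := 'rV[R]_d.
Variable P : probability T R.

Definition measurable_flow (theta : X -> T -> T) : Prop :=
  [/\ forall w, theta 0 w = w,
      forall x y w, theta (x + y) w = theta x (theta y w)
    & measurable_fun setT (fun p : T * X => theta p.2 p.1)].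

Definition preserves (theta : X -> T -> T) : Prop :=
  forall x A, measurable A -> P (theta x @^-1` A) = P A.

Definition random_cmeasure (Phi : T -> cmeasure R d) : Prop :=
  forall S, eval_sigma R d S -> measurable (Phi @^-1` S).

Definition cmeasure_invariant (theta : X -> T -> T) (Phi : T -> cmeasure R d) :
    Prop :=
  forall x w B, bounded_borel B -> Phi (theta x w) B = Phi w (translate B x).

Definition loc_sq_integrable (M : T -> set X -> \bar R) : Prop :=
  (\int[P]_w ((M w (eball 1)) ^+ 2) < +oo)%E.

Definition loc_abs_sq_integrable (Psi : T -> set X -> R[i]) : Prop :=
  loc_sq_integrable (fun w => tv (Psi w)).

Definition transport_kernel (K : T -> X -> fcmeasure R d) : Prop :=
  forall S, eval_sigma R d S -> measurable [set p : T * X | S (K p.1 p.2)].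

Definition kernel_invariant (theta : X -> T -> T)
    (K : T -> X -> fcmeasure R d) : Prop :=
  forall z w x B, bounded_borel B ->
    K (theta z w) x B = K w (x + z) (translate B z).

Definition kernel_star (K : T -> X -> fcmeasure R d) (w : T) (x : X) :
  set X -> R[i] := fun B => K w x (translate B x).

Definition uniformly_bounded_tv (K : T -> X -> fcmeasure R d) : Prop :=
  exists b : R, forall w x, (tv (K w x) setT <= b%:E)%E.

Definition kernel_apply (K : T -> X -> fcmeasure R d) (Phi : T -> cmeasure R d)
    (w : T) (B : set X) : R[i] :=
  cintegral (Phi w) (fun x => K w x B).

Definition abs_kernel_apply (K : T -> X -> fcmeasure R d)
    (Phi : T -> cmeasure R d) (w : T) (B : set X) : \bar R :=
  (\int[tv (Phi w)]_x tv (K w x) B)%E.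

Definition weighted_measure (rho : R -> R) (K : T -> X -> fcmeasure R d)
    (Phi : T -> cmeasure R d) (w : T) (B : set X) : \bar R :=
  (\int[tv (Phi w)]_(y in B) \int[tv (kernel_star K w y)]_x
     (Num.sqrt (enorm x ^+ d * rho (enorm x) + 1))%:E)%E.

End Random.

Definition strongly_log_dominating {R : realType} (rho : R -> R) : Prop :=
  [/\ forall r, 0 <= r -> 0 <= rho r,
      forall r s, 0 <= r -> r <= s -> rho r <= rho s
    & (\int[lebesgue_measure]_(r in `[0%R, +oo[%classic)
         ((r * rho r + 1)^-1)%:E < +oo)%E].

Section Skorokhod.
Context {R : realType} {d : nat}.
Local Notation X := 'rV[R]_d.
Local Notation E := (fcmeasure R d).

Definition metric_open {Y : Type} (dist : Y -> Y -> R) (U : set Y) : Prop :=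
  forall y, U y -> exists2 e : R, 0 < e & forall z, dist y z < e -> U z.

(* A metrization of the space of finite complex measures (identified when they
   agree on bounded Borel sets) whose Borel sigma-field makes the evaluations
   measurable. *)
Definition metrization (dist : E -> E -> R) : Prop :=
  [/\ forall mu nu, dist mu nu = 0 <->
        (forall B, bounded_borel B -> mu B = nu B),
      forall mu nu, dist mu nu = dist nu mu,
      forall la mu nu, dist la nu <= dist la mu + dist mu nu
    & forall S, eval_sigma R d S ->
        <<s metric_open dist >> [set nu : E | S nu]].

(* Quadrants of R^d with apex x, half-open on the side of x. *)
Definition quadrant (s : 'I_d -> bool) (x : X) : set X :=
  [set t | forall i, if s i then x 0 i <= t 0 i else t 0 i < x 0 i].

Definition quadrant_limit (dist : E -> E -> R) (f : X -> E)
    (s : 'I_d -> bool) (x : X) (l : E) : Prop :=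
  forall e : R, 0 < e -> exists2 a : R, 0 < a &
    forall t, quadrant s x t -> enorm (t - x) < a -> dist (f t) l < e.

(* For s constantly true the quadrant contains x, so the limit there is the value. *)
Definition cadlag (dist : E -> E -> R) (f : X -> E) : Prop :=
  forall x, quadrant_limit dist f (fun=> true) x (f x) /\
    forall s, exists l, quadrant_limit dist f s x l.

(* Time changes act coordinatewise by increasing bijections of R. *)
Definition time_change (la : 'I_d -> R -> R) : Prop :=
  forall i, {homo la i : u v / u < v} /\ forall v, exists u, la i u = v.

Definition skorokhod_nbhd (dist : E -> E -> R) (f : X -> E) (r e : R) :
    set (X -> E) :=
  [set g | exists la, time_change la /\ forall t, enorm t <= r ->
     let lat := \row_i la i (t 0 i) in
     enorm (lat - t) < e /\ dist (g t) (f lat) < e].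

(* Open sets of the Skorokhod (J1) topology on D(R^d, E): convergence means
   locally uniform convergence up to a time change that is locally uniformly
   close to the identity. *)
Definition skorokhod_open (dist : E -> E -> R) (U : set (X -> E)) : Prop :=
  U `<=` cadlag dist /\
  forall f, U f -> exists r e : R, 0 < e /\
    skorokhod_nbhd dist f r e `&` cadlag dist `<=` U.

Definition skorokhod_sigma (dist : E -> E -> R) : set (set (X -> E)) :=
  <<s cadlag dist, skorokhod_open dist >>.

Definition skorokhod_random_element {dT : measure_display}
    {T : measurableType dT} (dist : E -> E -> R) (K : T -> X -> E) : Prop :=
  (forall w, cadlag dist (K w)) /\
  forall S, skorokhod_sigma dist S -> measurable (K @^-1` S).

(* The metric on the space of finite complex measures is not fixed: any
   metrization is allowed. *)
Definition independent_kernel {dT : measure_display} {T : measurableType dT}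
    (P : probability T R) (K : T -> X -> E) (Phi : T -> cmeasure R d) : Prop :=
  exists dist : E -> E -> R,
    [/\ metrization dist, skorokhod_random_element dist K
      & forall S A, skorokhod_sigma dist S -> eval_sigma R d A ->
          P (K @^-1` S `&` Phi @^-1` A) =
          (P (K @^-1` S) * P (Phi @^-1` A))%E].

End Skorokhod.

(* Main.v *)
Require Import Defs.
From HB Require Import structures.
From mathcomp Require Import all_boot all_order all_algebra.
From mathcomp Require Import finmap complex.
From mathcomp Require Import all_classical all_reals all_analysis.
From mathcomp Require Import measurable_realfun.
From mathcomp Require Import zify ring lra.

Import Order.TTheory GRing.Theory Num.Theory.
Import numFieldNormedType.Exports.

Local Open Scope classical_set_scope.
Local Open Scope ring_scope.

Set Implicit Arguments.
Unset Strict Implicit.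
Unset Printing Implicit Defensive.

(** [tv] is replaced by the genuine measure [mvar], the sum of the upper
    variations of Re, - Re, Im and - Im, which satisfies tv <= mvar <= 4 tv.
    R^d is cut into the cells C_z = delta (z + [0,1)^d); N(z,u) is the
    |K|-mass sent from C_z to C_u.  Invariance makes (z,u) |-> E[N(z,u)^2]
    depend on u - z only, so everything reduces to bounding the second moment
    of sum_z N(z,0).

    (a) With weights h_u = |u|^d rho(|u|) + 1, whose inverses are summable since
    rho is strongly log-dominating, Cauchy-Schwarz gives
    E[(sum_z N(z,0))^2] <= (sum_u 1/h_u) E[sum_u h_u N(0,u)^2], and
    sum_u h_u N(0,u)^2 <= (sum_u sqrt(h_u) N(0,u))^2 is bounded by the square of
    the weighted measure of the unit ball.

    (b) Order the pairs (z,v) in the square of the sum by |v| <= |z| and bound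
    N(v,0) by b |Phi|(C_v).  Independence gives
    E[N(z,0) |Phi|(C_v)] <= const E[|K_0|(D_z)], where D_z is the set of
    displacements from C_z to C_0.  There are at most (2|z|+1)^d indices v, and
    sum_z (2|z|+1)^d 1_(D_z)(x) = O(1 + |x|^d). *)

(** * Integrals against set functions *)

(** All estimates are made over the finite boxes [box n] with constants uniform in n, and monotone
    convergence removes n at the end, so no sum has to be known finite beforehand. Square
    integrability of the mass sent into a bounded set then yields both the almost sure local
    finiteness of |K||Phi|, without which K Phi would be undefined, and the bound on its variation.

    In (a) the power of the weight is dictated by the dimension: a shell of radius r meets about
    r^(d-1) cells, so the sum of 1/h_u is controlled by the integral of 1/(r rho(r) + 1). In (b)
    there is no such weight; ordering the pairs leaves for each z only the v with |v| <= |z|, whose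
    number grows like |z|^d, and this is the moment assumed of K_0. The bound b is spent on the
    index v alone, so that what remains is linear in K and independence can separate it from Phi.

    The obstacle in (b) is measurability: independence concerns the sigma-algebras generated by K
    and by Phi, whereas Tonelli needs (w, x) -> K(w, x) to be jointly measurable for the former. The
    study of evaluation on the Skorokhod space supplies this. *)

Section lower_integral.
Local Open Scope ereal_scope.
Context {dT : measure_display} {T : measurableType dT} {R : realType}.
Implicit Types (m : set T -> \bar R) (f g : T -> \bar R).
Import HBNNSimple.

(* [tv] is only a set function, not known to be a measure: integrals against it
   are compared through their definition as a supremum over simple functions. *)
Definition nnsup m f := ereal_sup [set sintegral m h |
  h in [set h : {nnsfun T >-> R} | forall x, (h x)%:E <= f x]].

Lemma integral_mkcond_setfun m D f : \int[m]_(x in D) f x = \int[m]_x (f \_ D) x.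
Proof. by rewrite /integral patch_setT. Qed.

(** The integral is a difference of two suprema, for the positive and the negative part. The second
    vanishes because a zero simple function has empty fibres over every nonzero r, and
    [m set0 = 0]. *)
Lemma integral_nnsup m f : m set0 = 0 -> (forall x, 0 <= f x) ->
  \int[m]_x f x = nnsup m f.
Proof.
move=> m0 f0; rewrite /integral patch_setT.
rewrite (_ : f ^\+ = f); last by apply/funext => x; rewrite (@ge0_funeposE _ _ setT) ?inE.
rewrite (_ : f ^\- = cst 0); last first.
  by apply/funext => x; rewrite (@ge0_funenegE _ _ setT) ?inE.
suff -> : ereal_sup [set sintegral m h |
  h in [set h : {nnsfun T >-> R} | forall x, (h x)%:E <= cst 0 x]] = 0.
  by rewrite sube0.
have s0 (h : {nnsfun T >-> R}) : (forall x, h x = 0%R) -> sintegral m h = 0.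
  move=> h0; rewrite sintegralET fsbig1// => r _.
  have [->|r0] := eqVneq r 0%R; first by rewrite mul0e.
  rewrite (_ : h @^-1` [set r] = set0) ?m0 ?mule0//.
  by apply/seteqP; split => // x /=; rewrite h0 => /esym/eqP; rewrite (negbTE r0).
apply/eqP; rewrite eq_le; apply/andP; split.
  apply: ge_ereal_sup => _ [h /= hle <-]; rewrite s0// => x.
  by apply/eqP; rewrite eq_le fun_ge0 andbT -lee_fin.
apply: ereal_sup_ubound; exists nnsfun0 => //.
by rewrite s0.
Qed.

Lemma integral_lower_ge0 m f : m set0 = 0 ->
  (forall x, 0 <= f x) -> 0 <= \int[m]_x f x.
Proof.
move=> m0 f0; rewrite integral_nnsup//; apply: ereal_sup_ubound.
exists nnsfun0 => //; rewrite sintegralET fsbig1// => r _.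
have [->|r0] := eqVneq r 0%R; first by rewrite mul0e.
rewrite (_ : _ @^-1` [set r] = set0) ?m0 ?mule0//.
by apply/seteqP; split => // x /= /esym/eqP; rewrite (negbTE r0).
Qed.

Lemma sintegral_range m (h : {nnsfun T >-> R}) : m set0 = 0 ->
  sintegral m h = \sum_(r <- fset_set (range h)) r%:E * m (h @^-1` [set r]).
Proof.
move=> m0; apply: fsbigTE => r; rewrite in_fset_set// => /negP nr.
rewrite (_ : _ @^-1` _ = set0) ?m0 ?mule0//.
by apply/seteqP; split => // x /= hx; apply: nr; rewrite inE; exists x.
Qed.

Lemma le_sintegral_setfun m n (c : R) (h : {nnsfun T >-> R}) : (0 <= c)%R ->
  m set0 = 0 -> n set0 = 0 ->
  (forall A, measurable A -> 0 <= n A) ->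
  (forall A, measurable A -> m A <= c%:E * n A) ->
  sintegral m h <= c%:E * sintegral n h.
Proof.
move=> c0 m0 n0 nge mn.
rewrite !sintegral_range//.
rewrite big_seq [X in _ <= _ * X]big_seq ge0_sume_distrr; last first.
  move=> r; rewrite in_fset_set// inE => -[x _ <-].
  by rewrite mule_ge0 ?nge// lee_fin fun_ge0.
apply: lee_sum => r; rewrite in_fset_set// inE => -[x _ <-].
by rewrite muleCA lee_wpmul2l ?lee_fin ?fun_ge0// mn.
Qed.

(** Simple functions below [f] are also below [g], and their integrals compare fibre by fibre. This
    is the tool that passes between [tv] and [mvar]. *)
Lemma le_integral_setfun m n (c : R) f g : (0 <= c)%R ->
  m set0 = 0 -> n set0 = 0 ->
  (forall A, measurable A -> 0 <= n A) ->
  (forall A, measurable A -> m A <= c%:E * n A) ->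
  (forall x, 0 <= f x) -> (forall x, f x <= g x) ->
  \int[m]_x f x <= c%:E * \int[n]_x g x.
Proof.
move=> c0 m0 n0 nge mn f0 fg.
have g0 x : 0 <= g x by rewrite (le_trans (f0 x)).
rewrite !integral_nnsup//; apply: ge_ereal_sup => _ [h /= hf <-].
apply: (@le_trans _ _ (c%:E * sintegral n h)); first exact: le_sintegral_setfun.
rewrite lee_wpmul2l// ?lee_fin//; apply: ereal_sup_ubound.
by exists h => //= x; rewrite (le_trans (hf x)).
Qed.

Lemma le_integral_lower m f g : m set0 = 0 ->
  (forall A, measurable A -> 0 <= m A) ->
  (forall x, 0 <= f x) -> (forall x, f x <= g x) ->
  \int[m]_x f x <= \int[m]_x g x.
Proof.
move=> m0 mge f0 fg; rewrite -[leRHS]mul1e.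
by apply: le_integral_setfun => // A mA; rewrite mul1e.
Qed.

End lower_integral.

(** * Bounded Borel sets *)

Section bounded_sets.
Context {R : realType} {d : nat}.
Local Notation X := 'rV[R]_d.
Implicit Types A B : set X.

Lemma bounded_borel0 : bounded_borel (set0 : set X).
Proof. by split; [exact: measurable0|exists 0]. Qed.

Lemma bounded_borel_sub A B : measurable A -> A `<=` B -> bounded_borel B ->
  bounded_borel A.
Proof. by move=> mA AB [_ [r Br]]; split => //; exists r; exact: subset_trans Br. Qed.

Lemma bounded_borelU A B : bounded_borel A -> bounded_borel B ->
  bounded_borel (A `|` B).
Proof.
move=> [mA [r Ar]] [mB [s Bs]]; split; first exact: measurableU.
exists (Num.max r s) => x [/Ar|/Bs]; rewrite /eball /= => h.
  by rewrite lt_max h.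
by rewrite lt_max h orbT.
Qed.

Lemma bounded_borelI A B : measurable A -> bounded_borel B ->
  bounded_borel (A `&` B).
Proof.
by move=> mA [mB Bb]; apply: (bounded_borel_sub (B := B)) => //; exact: measurableI.
Qed.

Lemma bounded_borelD A B : bounded_borel A -> measurable B ->
  bounded_borel (A `\` B).
Proof.
by move=> [mA Ab] mB; apply: (bounded_borel_sub (B := A)) => //; exact: measurableD.
Qed.

End bounded_sets.

(** * Jordan decomposition and the variation measure *)

Section jordan.
Context {R : realType} {d : nat}.
Local Notation X := 'rV[R]_d.
Local Open Scope ereal_scope.

Definition is_signed_measure (s : set X -> R) :=
  exists mu nu : {measure set X -> \bar R}, [/\ locally_finite mu,
    locally_finite nu & forall B, bounded_borel B -> s B = (fine (mu B) - fine (nu B))%R].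

Variables (s : set X -> R) (hs : is_signed_measure s).

Lemma is_signed_measureN : is_signed_measure (fun A => - s A)%R.
Proof.
have [mu [nu [h1 h2 h3]]] := hs; exists nu, mu; split => // B /h3 ->.
by rewrite opprB.
Qed.

Lemma signed0 : s set0 = 0%R.
Proof.
have [mu [nu [_ _ h]]] := hs; rewrite h; last exact: bounded_borel0.
by rewrite !measure0 subrr.
Qed.

Lemma signedU A B : bounded_borel A -> bounded_borel B -> A `&` B = set0 ->
  s (A `|` B) = (s A + s B)%R.
Proof.
move=> bA bB AB; have [mu [nu [h1 h2 h]]] := hs.
rewrite !h//; last exact: bounded_borelU.
have [[mA _] [mB _]] := (bA, bB).
have fin (m : {measure set X -> \bar R}) C : locally_finite m -> bounded_borel C ->
    m C \is a fin_num by move=> hm bC; rewrite ge0_fin_numE// hm.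
by rewrite !measureU// !fineD ?fin//; ring.
Qed.

Lemma jordan_plus_ge0 B : 0 <= jordan_plus s B.
Proof.
apply: ereal_sup_ubound; exists set0; last by rewrite signed0.
by split => //; exact: bounded_borel0.
Qed.

Lemma jordan_plus0 : jordan_plus s set0 = 0.
Proof.
apply/eqP; rewrite eq_le jordan_plus_ge0 andbT.
by apply: ge_ereal_sup => _ [A [_ + <-]]; rewrite subset0 => ->; rewrite signed0.
Qed.

Lemma le_jordan_plus A B : A `<=` B -> jordan_plus s A <= jordan_plus s B.
Proof.
move=> AB; apply: ereal_sup_le => _ [C [bC CA] <-]; exists C => //.
by split => //; exact: subset_trans AB.
Qed.

Lemma jordan_plus_ge A B : bounded_borel A -> A `<=` B -> (s A)%:E <= jordan_plus s B.
Proof. by move=> bA AB; apply: ereal_sup_ubound; exists A. Qed.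

(** Competitors for [A] and [B] are disjoint, so their union competes for the union with the sum of
    the values. Subtracting the suprema one at a time needs finiteness; the infinite case is
    trivial. *)
Lemma jordan_plus_superU A B : A `&` B = set0 ->
  jordan_plus s A + jordan_plus s B <= jordan_plus s (A `|` B).
Proof.
move=> AB; have := leey (jordan_plus s (A `|` B)); rewrite le_eqVlt => /predU1P[->|fin].
  by rewrite leey.
have {}fin : jordan_plus s (A `|` B) \is a fin_num.
  by rewrite ge0_fin_numE// jordan_plus_ge0.
have finB : jordan_plus s B \is a fin_num.
  rewrite ge0_fin_numE ?jordan_plus_ge0//; apply: le_lt_trans (le_jordan_plus (@subsetUr _ A B)) _.
  by rewrite -ge0_fin_numE ?jordan_plus_ge0.
rewrite -leeBrDr//; apply: ge_ereal_sup => _ [A' [bA' A'A] <-].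
rewrite leeBrDr// addeC -leeBrDr//; apply: ge_ereal_sup => _ [B' [bB' B'B] <-].
rewrite leeBrDr// -EFinD; have A'B' : B' `&` A' = set0.
  by apply/seteqP; split => // x [/B'B Bx /A'A Ax]; rewrite -AB.
rewrite -signedU//; apply: jordan_plus_ge; first exact: bounded_borelU.
by move=> x [/B'B|/A'A]; [right|left].
Qed.

Lemma jordan_plus_superbig (F : (set X)^nat) n : trivIset setT F ->
  \sum_(0 <= i < n) jordan_plus s (F i) <= jordan_plus s (\big[setU/set0]_(i < n) F i).
Proof.
move=> tF; rewrite big_mkord; elim: n => [|n ih]; first by rewrite !big_ord0 jordan_plus0.
rewrite !big_ord_recr/=; apply: le_trans (jordan_plus_superU _).
  by rewrite leeD2r.
apply: (@trivIset_bigsetUI _ xpredT) => //.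
by move=> i j _ _; exact: tF.
Qed.

(** On a bounded set both measures representing [s] are finite, so their series converge in the
    reals and can be subtracted. *)
Lemma signed_cvg A (F : (set X)^nat) : bounded_borel A ->
  (forall i, measurable (F i)) -> trivIset setT F -> A `<=` \bigcup_i F i ->
  (fun n => \sum_(0 <= i < n) s (A `&` F i))%R @ \oo --> s A.
Proof.
move=> bA mF tF AF; have [mu [nu [h1 h2 h]]] := hs.
have cvg_ (m : {measure set X -> \bar R}) : locally_finite m ->
  (fun n => \sum_(0 <= i < n) fine (m (A `&` F i)))%R @ \oo --> fine (m A).
  move=> lm.
  have mAF i : measurable (A `&` F i) by apply: measurableI => //; have [] := bA.
  have finm i : m (A `&` F i) \is a fin_num.
    by rewrite ge0_fin_numE// lm// setIC; exact: bounded_borelI.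
  have c : (fun n => \sum_(0 <= i < n) m (A `&` F i)) @ \oo --> m A.
    have /setIidPl AFe := AF; rewrite -[in X in _ --> X]AFe setI_bigcupr.
    apply: measure_semi_sigma_additive => //.
    + exact: trivIset_setIl.
    + exact: bigcupT_measurable.
  have -> : (fun n => \sum_(0 <= i < n) fine (m (A `&` F i)))%R =
      fine \o (fun n => \sum_(0 <= i < n) m (A `&` F i)).
    apply/funext => n /=; apply: EFin_inj; rewrite -sumEFin fineK ?sum_fin_num//.
      by apply: eq_bigr => i _; rewrite fineK.
    by apply/allP => _ /mapP[i _ ->]; exact: finm.
  by apply: fine_cvg; rewrite fineK// ge0_fin_numE// lm.
rewrite h//.
rewrite (_ : (fun n => _) = (fun n => \sum_(0 <= i < n) fine (mu (A `&` F i)) -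
   \sum_(0 <= i < n) fine (nu (A `&` F i))))%R; last first.
  apply/funext => n; rewrite -sumrB; apply: eq_bigr => i _; rewrite h//.
  by rewrite setIC; exact: bounded_borelI.
by apply: cvgB; exact: cvg_.
Qed.

(** One inequality is finite superadditivity. For the other, a competitor [A] of the union has [s A]
    equal to the limit of the sums of [s (A & F i)], each of which is at most the upper variation of
    [F i]. *)
Lemma jordan_plus_sigma_additive : semi_sigma_additive (jordan_plus s).
Proof.
move=> F mF tF mU.
have ge0 i : 0 <= jordan_plus s (F i) by exact: jordan_plus_ge0.
apply: cvg_trans; first apply: (is_cvg_nneseries (P := xpredT)) => //.
rewrite (_ : \sum_(i <oo) _ = jordan_plus s (\bigcup_n F n)); first exact: cvg_id.
apply/eqP; rewrite eq_le; apply/andP; split.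
  apply: lime_le; first exact: is_cvg_nneseries.
  apply: nearW => n; apply: le_trans (jordan_plus_superbig n tF) _.
  by apply: le_jordan_plus; exact: bigsetU_bigcup.
apply: ge_ereal_sup => _ [A [bA AF] <-].
have c := signed_cvg bA mF tF AF.
set S := limn _; have [->|] := eqVneq S +oo; first by rewrite leey.
rewrite -ltey => Soo.
have S0 : 0 <= S by exact: nneseries_ge0.
have finS : S \is a fin_num by rewrite ge0_fin_numE.
rewrite -(fineK finS) lee_fin -(cvg_lim _ c)//; apply: limr_le; first by apply/cvg_ex; exists (s A).
apply: nearW => n; rewrite -lee_fin fineK// -sumEFin.
apply: le_trans (nneseries_lim_ge n _) => //.
apply: lee_sum => i _; apply: jordan_plus_ge; last by move=> x [].
by rewrite setIC; exact: bounded_borelI.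
Qed.
End jordan.

(** * The four parts of a complex measure and its variation *)

Section variation.
Context {R : realType} {d : nat}.
Local Notation X := 'rV[R]_d.
Local Open Scope ereal_scope.
Implicit Types (nu : cmeasure R d) (A B : set X).

(** Negation sits at odd indices, so that [jordan_minus] of the real or imaginary part is
    convertible to [jordan_plus] of the next index. Upper variations are then enough, also for
    unfolding [cintegral]. *)
Definition cpart (nu : set X -> R[i]) (k : nat) (B : set X) : R :=
  match k with
  | 0 => complex.Re (nu B)
  | 1 => - complex.Re (nu B)
  | 2 => complex.Im (nu B)
  | _ => - complex.Im (nu B)
  end%R.

Lemma cpart_signed nu k : is_signed_measure (cpart nu k).
Proof.
have [mu [hmu h]] := cmeasureP nu.
have re : is_signed_measure (cpart nu 0).
  by exists (mu (inord 0)), (mu (inord 1)); split => // B /h; rewrite /cpart => ->.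
have im : is_signed_measure (cpart nu 2).
  by exists (mu (inord 2)), (mu (inord 3)); split => // B /h; rewrite /cpart => ->.
case: k => [|[|[|k]]] //.
- exact: is_signed_measureN re.
- exact: is_signed_measureN im.
Qed.

Definition jpart nu k : set X -> \bar R := jordan_plus (cpart nu k).

HB.instance Definition _ nu k := isMeasure.Build _ X R (jpart nu k)
  (jordan_plus0 (cpart_signed nu k)) (jordan_plus_ge0 (cpart_signed nu k))
  (@jordan_plus_sigma_additive _ _ _ (cpart_signed nu k)).

Definition mvar nu : {measure set X -> \bar R} := msum (jpart nu) 4.

Lemma mvarE nu B : mvar nu B = jpart nu 0 B + jpart nu 1 B + jpart nu 2 B + jpart nu 3 B.
Proof. by rewrite /mvar /= /msum !big_ord_recr big_ord0/= add0e. Qed.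

Lemma le_mvar nu A B : A `<=` B -> mvar nu A <= mvar nu B.
Proof.
by move=> AB; apply: lee_sum => k _; exact: le_jordan_plus.
Qed.

Lemma tv_ge0 (nu : set X -> R[i]) B : 0 <= tv nu B.
Proof.
apply: ereal_sup_ubound; exists 0%N, (fun _ => set0); split => //.
- by move=> [].
- by move=> [].
- by rewrite big_ord0.
Qed.

Lemma le_tv (nu : set X -> R[i]) A B : A `<=` B -> tv nu A <= tv nu B.
Proof.
move=> AB; apply: ereal_sup_le => _ [n [F [hF tF ->]]]; exists n, F; split => // i.
by have [? FA] := hF i; split => //; exact: subset_trans AB.
Qed.

Lemma normc_ge0 (z : R[i]) : (0 <= ComplexField.Normc.normc z)%R.
Proof. by case: z => a b; exact: sqrtr_ge0. Qed.

Lemma jpart_le_mvar nu k B : (k < 4)%N -> jpart nu k B <= mvar nu B.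
Proof.
by move=> k4; rewrite /mvar /= /msum (bigD1 (Ordinal k4))//= leeDl// sume_ge0//.
Qed.

Lemma cpart_le_normc (nu : set X -> R[i]) k B :
  (cpart nu k B <= ComplexField.Normc.normc (nu B))%R.
Proof.
rewrite /cpart; case: (nu B) => a b /=.
have h (x y : R) : (`|x| <= Num.sqrt (x ^+ 2 + y ^+ 2))%R.
  by rewrite -sqrtr_sqr ler_wsqrtr// lerDl sqr_ge0.
have ha := h a b; have := h b a; rewrite addrC => hb.
have := ler_norm a; have := ler_norm b; have := ler_norm (- a)%R; have := ler_norm (- b)%R.
rewrite !normrN.
by case: k => [|[|[|k]]] /= *; lra.
Qed.

Lemma normc_le_cpart (nu : set X -> R[i]) B :
  (ComplexField.Normc.normc (nu B) <=
    Num.max (cpart nu 0 B) (cpart nu 1 B) + Num.max (cpart nu 2 B) (cpart nu 3 B))%R.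
Proof.
rewrite /cpart; case: (nu B) => a b /=.
have e (x : R) : Num.max x (- x)%R = `|x|%R.
  have [x0|x0] := leP 0%R x.
    by rewrite ger0_norm// max_l//; lra.
  by rewrite ltr0_norm// max_r//; lra.
rewrite !e.
have ab : (0 <= `|a| + `|b|)%R by rewrite addr_ge0.
rewrite -[leRHS](ger0_norm ab) -sqrtr_sqr ler_wsqrtr//.
rewrite (sqrrD `|a|) !real_normK ?num_real// lerD2r lerDl.
by rewrite mulrn_wge0// mulr_ge0.
Qed.

Lemma normc_le_mvar nu B : bounded_borel B ->
  (ComplexField.Normc.normc (nu B))%:E <= mvar nu B.
Proof.
move=> bB; apply: (@le_trans _ _ (Num.max (cpart nu 0 B) (cpart nu 1 B) +
  Num.max (cpart nu 2 B) (cpart nu 3 B))%:E); first by rewrite lee_fin normc_le_cpart.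
have h k l : (Num.max (cpart nu k B) (cpart nu l B))%:E <= jpart nu k B + jpart nu l B.
  rewrite /Num.max; case: ifPn => _.
    by apply: lee_paddl => //; exact: jordan_plus_ge.
  by apply: lee_paddr => //; exact: jordan_plus_ge.
by rewrite EFinD mvarE -addeA leeD.
Qed.

Lemma sum_mvar_le nu n (A : 'I_n -> set X) B :
  (forall i, measurable (A i) /\ A i `<=` B) -> trivIset setT A ->
  \sum_(i < n) mvar nu (A i) <= mvar nu B.
Proof.
move=> hA tA; rewrite -measure_bigsetU_ord//; last by move=> i; have [] := hA i.
apply: le_mvar; elim/big_ind : _ => // [C D CB DB x [/CB|/DB]//|i _].
by have [] := hA i.
Qed.

Lemma tv_le_mvar nu B : tv nu B <= mvar nu B.
Proof.
apply: ge_ereal_sup => _ [n [A [hA tA ->]]].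
apply: (@le_trans _ _ (\sum_(i < n) mvar nu (A i))).
  by rewrite -sumEFin; apply: lee_sum => i _; apply: normc_le_mvar; have [] := hA i.
by apply: sum_mvar_le => // i; have [[]] := hA i.
Qed.

Lemma jordan_plus_le_tv (nu : set X -> R[i]) k B : jordan_plus (cpart nu k) B <= tv nu B.
Proof.
apply: ge_ereal_sup => _ [A [bA AB] <-].
apply: (@le_trans _ _ (ComplexField.Normc.normc (nu A))%:E).
  by rewrite lee_fin cpart_le_normc.
apply: ereal_sup_ubound; exists 1%N, (fun _ => A); split => //.
- by move=> i j _ _ _; rewrite !ord1.
- by rewrite big_ord1.
Qed.

Lemma mvar_le_tv nu B : mvar nu B <= 4%:E * tv nu B.
Proof.
rewrite mvarE (_ : 4%:E * tv nu B = tv nu B + tv nu B + tv nu B + tv nu B).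
  by rewrite !leeD// jordan_plus_le_tv.
case: (tv nu B) (tv_ge0 nu B) => [r _| |//].
  by rewrite -EFinM -!EFinD; congr (_%:E); ring.
by rewrite gt0_muley ?lte_fin.
Qed.

Lemma tv0 nu : tv nu set0 = 0.
Proof.
by apply/eqP; rewrite eq_le tv_ge0 andbT (le_trans (tv_le_mvar _ _))// measure0.
Qed.

Lemma mvar_bounded nu B : bounded_borel B -> mvar nu B < +oo.
Proof.
move=> bB; rewrite mvarE.
have h k : jpart nu k B < +oo.
  have [mu [mu' [lmu lmu' h]]] := cpart_signed nu k.
  apply: le_lt_trans (lmu B bB); apply: ge_ereal_sup => _ [A [bA AB] <-].
  have mA := bA.1; have mB := bB.1.
  rewrite h//; apply: (@le_trans _ _ (fine (mu A))%:E).
    by rewrite lee_fin gerBl fine_ge0.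
  by rewrite fineK ?ge0_fin_numE ?lmu// le_measure ?inE.
by rewrite !lte_add_pinfty.
Qed.

End variation.

Lemma countable_enum {I : Type} (D : set I) (i0 : I) : countable D -> D i0 ->
  exists e : nat -> I, (forall n, D (e n)) /\ forall i, D i -> exists n, e n = i.
Proof.
move=> /countable_injP[f fi] D0.
have h n : exists j, D j /\ forall i, D i -> f i = n -> j = i.
  have [[i [Di fin]]|h] := pselect (exists i, D i /\ f i = n).
    exists i; split => // j Dj fj; apply: fi; rewrite ?inE//.
    by rewrite fin.
  by exists i0; split => // i Di fin; exfalso; apply: h; exists i.
have [e he] := choice h.
by exists e; split => [n|i Di]; [have [] := he n|by exists (f i); have [_ /(_ i Di erefl)] := he (f i)].
Qed.

(** * Measurability of the variation *)

Section borel_rV.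
Context {R : realType} {d : nat}.
Local Notation X := 'rV[R]_d.

Lemma open_measurable_rV (U : set X) : open U -> measurable U.
Proof. by move=> oU; exact: sub_sigma_algebra. Qed.

Lemma measurable_coord (i : 'I_d) : measurable_fun setT (fun x : X => x 0 i).
Proof.
apply: (measurability _ (measurable_realfun.RGenOpens.measurableE R)) => _ [_ [a [b ->]] <-].
rewrite setTI; apply: open_measurable_rV.
by have /continuousP := @coord_continuous R 1 d 0 i; apply; exact: interval_open.
Qed.

Lemma measurable_coordset (P : 'I_d -> set R) : (forall i, measurable (P i)) ->
  measurable [set x : X | forall i, P i (x 0 i)].
Proof.
move=> mP; rewrite (_ : mkset _ = \bigcap_(i in setT) (fun x : X => x 0 i) @^-1` P i).
  apply: fin_bigcap_measurable => // i _; rewrite -[X in measurable X]setTI.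
  exact: measurable_coord.
by apply/seteqP; split => [x h i _|x h i]; [exact: h|exact: h i I].
Qed.

Lemma coord_le_enorm (x : X) i : `|x 0 i| <= enorm x.
Proof.
rewrite -sqrtr_sqr ler_wsqrtr// (bigD1 i)//= lerDl sumr_ge0// => j _.
exact: sqr_ge0.
Qed.

Lemma enorm_le_coord (x : X) c : 0 <= c -> (forall i, `|x 0 i| <= c) -> enorm x <= d%:R * c.
Proof.
move=> c0 h; have dc : 0 <= d%:R * c by rewrite mulr_ge0.
rewrite -[leRHS](ger0_norm dc) -sqrtr_sqr ler_wsqrtr//.
apply: (@le_trans _ _ (\sum_(i < d) c ^+ 2)).
  by apply: ler_sum => i _; rewrite -real_normK ?num_real// lerXn2r ?nnegrE.
rewrite sumr_const card_ord exprMn -[c ^+ 2 *+ d]mulr_natl ler_wpM2r ?sqr_ge0//.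
by rewrite -natrX ler_nat; case: (d) => // n; rewrite expnS leq_pmulr.
Qed.

Definition cube (k : nat) : set X := [set x | forall i, -(k%:R) <= x 0 i < k%:R].

Lemma bounded_cube k : bounded_borel (cube k).
Proof.
split.
  exact: (@measurable_coordset (fun=> `[-(k%:R), k%:R[%classic)).
exists (d%:R * k%:R + 1) => x h; rewrite /eball /=.
apply: (@le_lt_trans _ _ (d%:R * k%:R)); last by rewrite ltrDl.
by apply: enorm_le_coord => // i; have /andP[? ?] := h i; rewrite ler_norml; lra.
Qed.

Lemma eball_cube r : exists k, eball r `<=` cube k.
Proof.
have [k hk] : exists k : nat, r <= k%:R.
  exists (Num.truncn `|r|).+1; apply: le_trans (ler_norm r) _.
  by rewrite ltW// truncnS_gt.
exists k => x; rewrite /eball /= => xr i.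
have := coord_le_enorm x i; have := ler_norm (x 0 i); have := ler_norm (- x 0 i).
by rewrite normrN => *; apply/andP; split; lra.
Qed.

Definition rbox (p : 'rV[rat]_d * 'rV[rat]_d) : set X :=
  [set x | forall i, ratr (p.1 0 i) < x 0 i < ratr (p.2 0 i)].

Lemma measurable_rbox p : measurable (rbox p).
Proof.
exact: (@measurable_coordset (fun i => `]ratr (p.1 0 i), ratr (p.2 0 i)[%classic)).
Qed.

Lemma open_rbox (U : set X) x : open U -> U x -> exists p, rbox p x /\ rbox p `<=` U.
Proof.
move=> oU Ux; have /nbhs_ballP[e /= e0 eU] : nbhs x U by exact: open_nbhs_nbhs.
have h i : exists q : rat * rat, (x 0 i - e < ratr q.1 < x 0 i) /\
    (x 0 i < ratr q.2 < x 0 i + e).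
  have [q] := @rat_in_itvoo R (x 0 i - e) (x 0 i) ltac:(lra).
  have [q'] := @rat_in_itvoo R (x 0 i) (x 0 i + e) ltac:(lra).
  by rewrite !in_itv /= => ? ?; exists (q, q').
have [q hq] := choice h.
exists (\row_i (q i).1, \row_i (q i).2); split.
  by move=> i; rewrite !mxE; have [/andP[? ?] /andP[? ?]] := hq i; apply/andP.
move=> y hy; apply: eU; split => // i j; rewrite ord1 /ball /=.
have := hy j; rewrite !mxE => /andP[? ?].
by have [/andP[? ?] /andP[? ?]] := hq j; rewrite ltr_norml; apply/andP; split; lra.
Qed.

Lemma open_bigcup_rbox (U : set X) : open U -> exists F : nat -> set X,
  (forall n, F n = set0 \/ exists p, F n = rbox p) /\ U = \bigcup_n F n.
Proof.
move=> oU; have [->|/set0P[x0 Ux0]] := eqVneq U set0.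
  by exists (fun=> set0); split; [left|rewrite bigcup0].
have [p0 [_ p0U]] := open_rbox oU Ux0.
have [e [eU He]] := @countable_enum _ [set p | rbox p `<=` U] p0 (countableP _) p0U.
exists (rbox \o e); split; first by move=> n; right; exists (e n).
apply/seteqP; split => [t Ut|t [n _]]; last exact: eU.
have [p [fp pU]] := open_rbox oU Ut; have [n en] := He _ pU.
by exists n => //=; rewrite en.
Qed.

Lemma measurable_fun_rV {dT} {T : measurableType dT} (f : T -> X) :
  (forall i, measurable_fun setT (fun t => f t 0 i)) -> measurable_fun setT f.
Proof.
move=> mf; apply: (measurability (@open X)) => //.
move=> _ [U oU <-]; rewrite setTI.
have mb p : measurable (f @^-1` rbox p).
  rewrite (_ : _ @^-1` _ = \bigcap_(i in setT) (fun t => f t 0 i) @^-1`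
      `]ratr (p.1 0 i), ratr (p.2 0 i)[%classic).
    apply: fin_bigcap_measurable => // i _; rewrite -[X in measurable X]setTI.
    exact: mf.
  apply/seteqP; split => [t h i _|t h i]; rewrite /preimage /= ?in_itv; first exact: h.
  by have := h i I; rewrite /preimage /= in_itv.
have [F [hF ->]] := open_bigcup_rbox oU.
rewrite preimage_bigcup; apply: bigcupT_measurable => n.
by have [->|[p ->]] := hF n; [rewrite preimage_set0|].
Qed.

Lemma measurable_shift (a : X) : measurable_fun setT (fun x : X => x + a).
Proof.
apply: measurable_fun_rV => i; under eq_fun do rewrite mxE.
by apply: measurable_funD => //; exact: measurable_coord.
Qed.

Lemma translateE (B : set X) a : translate B a = (fun x => x + - a) @^-1` B.
Proof.
apply/seteqP; split => [_ [y By <-]|x Bx]; first by rewrite /preimage /= addrK.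
by exists (x - a) => //; rewrite subrK.
Qed.

Lemma measurable_translate (B : set X) a : measurable B -> measurable (translate B a).
Proof.
by move=> mB; rewrite translateE -[X in measurable X]setTI; exact: measurable_shift.
Qed.

(* A countable algebra generating the Borel sets.  Approximation by its members
   makes the supremum defining [jordan_plus] countable, hence measurable in the
   measure. *)
Definition nor (A B : set X) := ~` (A `|` B).

(** Complement and union are both expressible through [nor], so one closure operation per level
    suffices. *)
Fixpoint alg_rec n : set (set X) := match n with
  | 0 => range rbox
  | n.+1 => alg_rec n `|` [set nor p.1 p.2 | p in alg_rec n `*` alg_rec n]
  end.

Definition rat_alg : set (set X) := \bigcup_n alg_rec n.

Lemma countable_rat_alg : countable rat_alg.
Proof.
apply: bigcup_countable => // n _; elim: n => [|n ih] /=.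
  by apply: sub_countable (card_image_le _ _) _.
rewrite -bigcup2E; apply: bigcup_countable => // -[|[|i]] _ //=.
by apply: sub_countable (card_image_le _ _) _; exact: countableX.
Qed.

Lemma alg_rec_homo m n : (m <= n)%N -> alg_rec m `<=` alg_rec n.
Proof.
move=> /subnK <-; elim: (n - m)%N => // k ih; apply: subset_trans ih _.
by rewrite addSn => A; left.
Qed.

Lemma rat_alg_nor A B : rat_alg A -> rat_alg B -> rat_alg (nor A B).
Proof.
move=> [m _ hA] [n _ hB]; exists (maxn m n).+1 => //; right; exists (A, B) => //.
by split; [apply: alg_rec_homo hA|apply: alg_rec_homo hB]; rewrite ?leq_maxl ?leq_maxr.
Qed.

Lemma rat_algC A : rat_alg A -> rat_alg (~` A).
Proof. by move=> h; have := rat_alg_nor h h; rewrite /nor setUid. Qed.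

Lemma rat_algU A B : rat_alg A -> rat_alg B -> rat_alg (A `|` B).
Proof.
move=> hA hB; rewrite -[A `|` B]setCK; apply: rat_algC; exact: rat_alg_nor.
Qed.

Lemma rat_alg_box p : rat_alg (rbox p).
Proof. by exists 0%N => //; exists p. Qed.

Lemma rat_alg0 : rat_alg set0.
Proof.
have h := rat_alg_box (0, 0); rewrite (_ : set0 = nor (rbox (0, 0)) (~` rbox (0, 0))).
  by apply: rat_alg_nor => //; exact: rat_algC.
by rewrite /nor setUCr setCT.
Qed.

Lemma measurable_rat_alg A : rat_alg A -> measurable A.
Proof.
move=> [n _]; elim: n A => [|n ih] A /=; first by move=> [p _ <-]; exact: measurable_rbox.
move=> [/ih//|[[B C] [/= /ih mB /ih mC] <-]].
by apply: measurableC; exact: measurableU.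
Qed.

Section approx.
Variable mu : {measure set X -> \bar R}.
Hypothesis mufin : (mu setT < +oo)%E.

Definition approximable (A : set X) := measurable A /\
  forall e : R, 0 < e -> exists2 E, rat_alg E & (mu ((A `\` E) `|` (E `\` A)) < e%:E)%E.

Lemma mu_fin A : measurable A -> mu A \is a fin_num.
Proof.
move=> mA; rewrite ge0_fin_numE// (le_lt_trans _ mufin)// le_measure ?inE//.
Qed.

Lemma approximableC A : approximable A -> approximable (~` A).
Proof.
move=> [mA h]; split => [|e /h[E hE lt]]; first exact: measurableC.
exists (~` E); first exact: rat_algC.
rewrite (_ : _ `|` _ = (A `\` E) `|` (E `\` A))//.
by rewrite !setDE !setCK setUC [X in X `|` _]setIC [X in _ `|` X]setIC.
Qed.

(** Finiteness of [mu] lets the union be cut at some N up to e/2; the N remaining sets share the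
    other e/2. *)
Lemma approximable_bigcup (F : (set X)^nat) : (forall n, approximable (F n)) ->
  approximable (\bigcup_n F n).
Proof.
move=> hF; have mF n : measurable (F n) by have [] := hF n.
have mU : measurable (\bigcup_n F n) by exact: bigcupT_measurable.
split => // e e0.
pose U n := \big[setU/set0]_(i < n) F i.
have mUn n : measurable (U n) by apply: bigsetU_measurable => i _.
have [N hN] : exists N, (mu (\bigcup_n F n `\` U N) < (e / 2)%:E)%E.
  have c : mu \o U @ \oo --> mu (\bigcup_n U n).
    apply: nondecreasing_cvg_mu => //; first exact: bigcupT_measurable.
    by move=> m n mn; apply/subsetPset; exact: subset_bigsetU.
  have UF : \bigcup_n U n = \bigcup_n F n.
    apply/seteqP; split => [x [n _]|x [n _ Fn]].
      by rewrite /U -bigcup_mkord => -[i _ Fi]; exists i.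
    by exists n.+1 => //; rewrite /U -bigcup_mkord; exists n => /=.
  rewrite UF in c.
  have /fine_cvgP[_ c'] : mu \o U @ \oo --> (fine (mu (\bigcup_n F n)))%:E.
    by rewrite fineK// mu_fin.
  have /cvgrPdist_lt/(_ _ (divr_gt0 e0 (ltr0Sn _ 1)))[N _ /(_ N (leqnn _))] /= := c'.
  move=> hN; exists N.
  have mUN : (mu (\bigcup_n F n `\` U N) = mu (\bigcup_n F n) - mu (U N))%E.
    rewrite measureD//; last by rewrite -ge0_fin_numE ?mu_fin.
    by rewrite setIidr//; exact: bigsetU_bigcup.
  rewrite mUN -[X in (X - _)%E]fineK ?mu_fin// -[X in (_ - X)%E]fineK ?mu_fin//.
  by rewrite -EFinB lte_fin; exact: le_lt_trans (ler_norm _) hN.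
(* Dividing by N + 1 instead of N keeps the tolerance positive when N = 0. *)
have eN : 0 < e / 2 / N.+1%:R by rewrite !divr_gt0.
have hE i : exists E, rat_alg E /\
    (mu ((F i `\` E) `|` (E `\` F i)) < (e / 2 / N.+1%:R)%:E)%E.
  by have [E ? ?] := (hF i).2 _ eN; exists E.
have [G hG] := choice hE.
exists (\big[setU/set0]_(i < N) G i).
  by elim/big_ind : _ => //; [exact: rat_alg0|exact: rat_algU|move=> i _; have [] := hG i].
have mG i : measurable (G i) by apply: measurable_rat_alg; have [] := hG i.
pose Dl i := (F i `\` G i) `|` (G i `\` F i).
have mD i : measurable (Dl i).
  by apply: measurableU; exact: measurableD.
apply: (@le_lt_trans _ _ (mu ((\bigcup_n F n `\` U N) `|`
   \big[setU/set0]_(i < N) Dl i))).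
  apply: le_measure; rewrite ?inE.
  - apply: measurableU; apply: measurableD => //;
    by apply: bigsetU_measurable => i _.
  - apply: measurableU; first exact: measurableD.
    by apply: bigsetU_measurable => i _.
  - rewrite /U -!bigcup_mkord => x [[[n _ Fn] nG]|[[n nN Gn] nF]].
      have [[i iN Fi]|nU] := pselect ((\bigcup_(i < N) F i) x).
        right; exists i => //; left; split => //; apply: contra_not nG => Gi.
        by exists i.
      by left; split => //; exists n.
    right; exists n => //; right; split => //; apply: contra_not nF => Fn.
    by exists n.
apply: le_lt_trans (measureU2 _ _ _) _ => //; first exact: measurableD.
  by apply: bigsetU_measurable => i _.
rewrite [e in e%:E]splitr EFinD; apply: lte_leD => //.
  by rewrite ge0_fin_numE// (le_lt_trans _ mufin)// le_measure ?inE//; apply: bigsetU_measurable => i _.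
apply: (@le_trans _ _ (\sum_(i < N) mu (Dl i))%E); first exact: Boole_inequality.
apply: (@le_trans _ _ (\sum_(i < N) (e / 2 / N.+1%:R)%:E)%E).
  by apply: lee_sum => i _; apply/ltW; have [] := hG i.
rewrite sumEFin lee_fin sumr_const card_ord -[leLHS]mulr_natl mulrCA ler_piMr ?divr_ge0 ?(ltW e0)//.
by rewrite ler_pdivrMr// mul1r ler_nat.
Qed.

Lemma measurable_approximable A : measurable A -> approximable A.
Proof.
move: A; apply: smallest_sub; first split.
- split => // e e0; exists set0; first exact: rat_alg0.
  by rewrite !setD0 setU0 measure0 lte_fin.
- by move=> A hA; rewrite setTD; exact: approximableC.
- exact: approximable_bigcup.
move=> U oU.
have bapp p : approximable (rbox p).
  split; first exact: measurable_rbox.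
  move=> e e0; exists (rbox p); first exact: rat_alg_box.
  by rewrite setDv setU0 measure0 lte_fin.
have [F [hF ->]] := open_bigcup_rbox oU.
apply: approximable_bigcup => n; have [->|[p ->]//] := hF n.
split => // e e0; exists set0; first exact: rat_alg0.
by rewrite !setD0 setU0 measure0 lte_fin.
Qed.

End approx.

(** A competitor [A] lies in some cube, where the sum of the two measures behind [s] is finite.
    Replacing [A] by an approximating [E] cut down to [B] and the cube changes [s] by at most the
    measure of the symmetric difference. *)
Lemma jordan_plus_gt (s : set X -> R) (hs : is_signed_measure s) B r :
  measurable B -> (r%:E < jordan_plus s B)%E <->
  exists k E, rat_alg E /\ r < s (E `&` (B `&` cube k)).
Proof.
move=> mB; split; last first.
  move=> [k [E [hE rs]]]; have mE := measurable_rat_alg hE.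
  have bk := @bounded_cube k.
  apply: (@lt_le_trans _ _ (s (E `&` (B `&` cube k)))%:E); first by rewrite lte_fin.
  apply: jordan_plus_ge; last by move=> x [_ []].
  by apply: bounded_borelI => //; exact: bounded_borelI.
move=> /ereal_sup_gt[_ [A [bA AB] <-]]; rewrite lte_fin => rs.
have [t At] := bA.2; have [k tk] := eball_cube t.
have Ak : A `<=` cube k by exact: subset_trans tk.
have mA := bA.1; have mQ := (@bounded_cube k).1.
have [nu1 [nu2 [l1 l2 sE]]] := hs.
(* The control measure: it dominates both parts of [s] inside the cube. The tolerance asked of it
   below is the available slack [s A - r]. *)
pose mu := mrestr (measure_add nu1 nu2) mQ.
have muE D : mu D = (nu1 (D `&` cube k) + nu2 (D `&` cube k))%E.
  by rewrite /mu /mrestr measure_addE.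
have mufin : (mu setT < +oo)%E.
  by rewrite muE setTI lte_add_pinfty// ?l1 ?l2//; exact: bounded_cube.
have [_ /(_ (s A - r))[|E hE]] := @measurable_approximable mu mufin A mA; first by rewrite subr_gt0.
have mE := measurable_rat_alg hE.
set D := (_ `|` _) => muD; exists k, E; split => //.
have mD : measurable D by apply: measurableU; exact: measurableD.
set C := E `&` _.
have bC : bounded_borel C.
  by apply: bounded_borelI => //; apply: bounded_borelI => //; exact: bounded_cube.
have mC := bC.1.
have bDQ : bounded_borel (D `&` cube k) by apply: bounded_borelI => //; exact: bounded_cube.
have fin (m : {measure set X -> \bar R}) S : locally_finite m -> bounded_borel S ->
    m S \is a fin_num by move=> hm bS; rewrite ge0_fin_numE// hm.
have bCA : bounded_borel (C `&` A) by exact: bounded_borelI.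
have bCD : bounded_borel (C `\` A) by exact: bounded_borelD.
have bAD : bounded_borel (A `\` C) by exact: bounded_borelD.
have sC : s C = s (C `&` A) + s (C `\` A).
  rewrite -signedU//; first by rewrite setUIDK.
  by rewrite setDE setIACA setICr setI0.
have sA : s A = s (C `&` A) + s (A `\` C).
  rewrite -signedU//; first by rewrite [C `&` A]setIC setUIDK.
  by rewrite [C `&` A]setIC setDE setIACA setICr setI0.
(* Points added to [A] cost at most [nu2], points removed from it cost at most [nu1]; both lie in
   the symmetric difference. *)
have h1 : - fine (nu2 (D `&` cube k)) <= s (C `\` A).
  rewrite sE//; have : fine (nu2 (C `\` A)) <= fine (nu2 (D `&` cube k)).
    apply: fine_le; rewrite ?fin// le_measure ?inE//; first exact: bCD.1.
      exact: bDQ.1.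
    by move=> x [[Ex [Bx Qx]] nA]; split => //; right.
  have : 0 <= fine (nu1 (C `\` A)) by rewrite fine_ge0.
  lra.
have h2 : s (A `\` C) <= fine (nu1 (D `&` cube k)).
  rewrite sE//; have : fine (nu1 (A `\` C)) <= fine (nu1 (D `&` cube k)).
    apply: fine_le; rewrite ?fin// le_measure ?inE//; first exact: bAD.1.
      exact: bDQ.1.
    move=> x [Ax nC]; split; last exact: Ak.
    left; split => // Ex; apply: nC; split => //; split; [exact: AB|exact: Ak].
  have : 0 <= fine (nu2 (A `\` C)) by rewrite fine_ge0.
  lra.
have : fine (nu1 (D `&` cube k)) + fine (nu2 (D `&` cube k)) < s A - r.
  by rewrite -lte_fin EFinD !fineK ?fin// -muE.
lra.
Qed.

End borel_rV.

Section measurable_mvar.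
Context {R : realType} {d : nat} {dT : measure_display} {T : measurableType dT}.
Local Notation X := 'rV[R]_d.
Variable Phi : T -> cmeasure R d.
Hypothesis mPhi : forall S, eval_sigma R d S -> measurable (Phi @^-1` S).

Lemma measurable_cpart k B : bounded_borel B -> measurable_fun setT (fun w => cpart (Phi w) k B).
Proof.
move=> bB.
have re : measurable_fun setT (fun w => complex.Re (Phi w B)).
  move=> _ Y mY; rewrite setTI.
  apply: (mPhi (S := [set nu : cmeasure R d | Y (complex.Re (nu B))])).
  apply: sub_sigma_algebra; exists B, (Y `*` setT); split => //; first exact: measurableX.
  by apply/seteqP; split => nu //= [].
have im : measurable_fun setT (fun w => complex.Im (Phi w B)).
  move=> _ Y mY; rewrite setTI.
  apply: (mPhi (S := [set nu : cmeasure R d | Y (complex.Im (nu B))])).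
  apply: sub_sigma_algebra; exists B, (setT `*` Y); split => //; first exact: measurableX.
  by apply/seteqP; split => nu //= [].
by rewrite /cpart; case: k => [|[|[|k]]] //=; exact: measurable_funN.
Qed.

Lemma measurable_jpart k B : measurable B -> measurable_fun setT (fun w => jpart (Phi w) k B).
Proof.
move=> mB; apply: (measurability _ (ErealGenOInfty.measurableE R)) => _ [_ [r ->] <-].
rewrite setTI.
have [e [eA He]] := countable_enum (@countable_rat_alg R d) (@rat_alg0 R d).
rewrite (_ : _ @^-1` _ = \bigcup_k' \bigcup_n
    [set w | r < cpart (Phi w) k (e n `&` (B `&` cube k'))]).
  apply: bigcupT_measurable => k'; apply: bigcupT_measurable => n.
  have bb : bounded_borel (e n `&` (B `&` cube k')).
    apply: bounded_borelI; first exact: measurable_rat_alg.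
    by apply: bounded_borelI => //; exact: bounded_cube.
  have := measurable_cpart k bb measurableT (measurable_itv `]r, +oo[%R).
  by rewrite setTI; congr measurable; apply/seteqP; split => w;
    rewrite /preimage /= in_itv /= andbT.
apply/seteqP; split => w; rewrite /preimage /= in_itv /= andbT.
  move=> /(jordan_plus_gt (cpart_signed (Phi w) k) r mB)[k' [E [hE rs]]].
  by have [n en] := He _ hE; exists k' => //; exists n => //=; rewrite en.
move=> [k' _ [n _ /= h]]; apply/(jordan_plus_gt (cpart_signed (Phi w) k) r mB).
by exists k', (e n).
Qed.

Lemma measurable_mvar B : measurable B -> measurable_fun setT (fun w => mvar (Phi w) B).
Proof.
move=> mB; under eq_fun do rewrite mvarE.
by do ![apply: emeasurable_funD]; exact: measurable_jpart.
Qed.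

End measurable_mvar.

Lemma sum_disjoint_indic {R : realType} {I : eqType} {T : Type} (s : seq I)
    (F : I -> set T) (a : I -> R) (M : R) x : uniq s ->
  (forall i j, i \in s -> j \in s -> F i x -> F j x -> i = j) ->
  0 <= M -> (forall i, i \in s -> F i x -> a i <= M) ->
  \sum_(i <- s) a i * \1_(F i) x <= M.
Proof.
elim: s => [|i s ih] /=; first by rewrite big_nil.
move=> /andP[nis us] tF M0 aM; rewrite big_cons.
have [Fx|nFx] := pselect (F i x).
  rewrite big_seq big1 ?addr0.
    by rewrite indicE mem_set// mulr1 aM// mem_head.
  move=> j js; rewrite indicE memNset ?mulr0// => Fj.
  have ij := tF i j (mem_head _ _) (mem_behead (s := i :: s) js) Fx Fj.
  by rewrite ij js in nis.
rewrite indicE memNset// mulr0 add0r; apply: ih => // [j k js ks|j js].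
  by apply: tF; rewrite in_cons ?js ?ks orbT.
by apply: aM; rewrite in_cons js orbT.
Qed.

(** * Lattice cells *)

Section cells.
Context {R : realType} {d : nat}.
Local Notation X := 'rV[R]_d.
Local Notation Z := 'rV[int]_d.

(* With this mesh [cell 0] is contained in the open unit ball. *)
Definition delta : R := d.+1%:R^-1.

Lemma delta_gt0 : 0 < delta.
Proof. by rewrite invr_gt0. Qed.

Definition latt (z : Z) : X := \row_i (delta * (z 0 i)%:~R).

Definition cell_of (x : X) : Z := \row_i Num.floor (x 0 i / delta).

Definition cell (z : Z) : set X := [set x | cell_of x = z].

Lemma cellP z x : cell z x <-> forall i, delta * (z 0 i)%:~R <= x 0 i < delta * (z 0 i + 1)%:~R.
Proof.
have xE i : x 0 i = delta * (x 0 i / delta) by rewrite mulrC divfK// gt_eqF// delta_gt0.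
split => [<- i|h].
  by rewrite [X in _ <= X < _]xE ler_pM2l ?delta_gt0// ltr_pM2l ?delta_gt0// mxE floor_itv.
apply/rowP => i; rewrite mxE; apply: floor_def.
by have := h i; rewrite [X in _ <= X < _]xE ler_pM2l ?delta_gt0// ltr_pM2l ?delta_gt0.
Qed.

Lemma measurable_cell z : measurable (cell z).
Proof.
have := @measurable_coordset R d
  (fun i => `[delta * (z 0 i)%:~R, delta * (z 0 i + 1)%:~R[%classic)
  (fun=> measurable_itv _).
congr measurable; apply/seteqP; split => x /=.
  by move=> h; apply/cellP => i; have := h i; rewrite /= in_itv.
by move/cellP => h i; rewrite /= in_itv; exact: h.
Qed.

Lemma cell_translate z v : translate (cell z) (latt v) = cell (z + v).
Proof.
rewrite translateE; apply/seteqP; split => x /cellP h; apply/cellP => i;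
  have := h i; rewrite !mxE !intrD; lra.
Qed.

Lemma bounded_cell z : bounded_borel (cell z).
Proof.
split; first exact: measurable_cell.
pose c := \sum_i (`|delta * (z 0 i)%:~R| + delta).
have c0 : 0 <= c by rewrite sumr_ge0// => i _; rewrite addr_ge0// ltW// delta_gt0.
exists (d%:R * c + 1) => x /cellP h; rewrite /eball /=.
apply: (@le_lt_trans _ _ (d%:R * c)); last by rewrite ltrDl.
apply: enorm_le_coord => // i; rewrite /c (bigD1 i)//=.
have : 0 <= \sum_(j | j != i) (`|delta * (z 0 j)%:~R| + delta).
  by rewrite sumr_ge0// => j _; rewrite addr_ge0// ltW// delta_gt0.
have := h i; rewrite intrD mulrDr mulr1.
have := ler_norm (delta * (z 0 i)%:~R); have := ler_norm (- (delta * (z 0 i)%:~R)).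
have := delta_gt0; rewrite normrN ler_norml; lra.
Qed.

Lemma cell0_eball : cell 0 `<=` eball 1.
Proof.
move=> x /cellP h; rewrite /eball /=.
apply: (@le_lt_trans _ _ (d%:R * delta)); last first.
  by rewrite /delta ltr_pdivrMr// mul1r ltr_nat.
apply: enorm_le_coord; first by rewrite ltW// delta_gt0.
move=> i; have := h i; rewrite mxE mulr0 add0r mulr1 ler_norml; have := delta_gt0; lra.
Qed.

Definition mnorm (z : Z) : nat := \max_(i < d) absz (z 0%R i).

Lemma le_mnorm z n : (mnorm z <= n)%N = [forall i, (absz (z 0%R i) <= n)%N].
Proof.
apply/bigmax_leqP/forallP => h i; first exact: h.
by move=> _; exact: h.
Qed.

Lemma mnormN z : mnorm (- z) = mnorm z.
Proof. by apply: eq_bigr => i _; rewrite mxE abszN. Qed.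

Lemma mnorm_attained z : (0 < mnorm z)%N -> exists i, mnorm z = absz (z 0 i).
Proof.
rewrite /mnorm => z0; have [|i ->] := @bigop.eq_bigmax _ (fun i => absz (z 0 i)); last by exists i.
rewrite card_ord lt0n; apply: contraTneq z0 => d0.
by rewrite big1// => i; have := ltn_ord i; rewrite {2}d0.
Qed.

Definition box_pt n (f : {ffun 'I_d -> 'I_(n.*2.+1)}) : Z := \row_i (Posz (f i) - Posz n).

Definition box n : seq Z := codom (@box_pt n).

Lemma box_pt_inj n : injective (@box_pt n).
Proof.
move=> f g /rowP h; apply/ffunP => i; have := h i; rewrite !mxE.
by move=> /(congr1 (fun t => t + n%:Z)); rewrite !subrK => -[/val_inj].
Qed.

Lemma box_uniq n : uniq (box n).
Proof. by rewrite map_inj_uniq ?enum_uniq//; exact: box_pt_inj. Qed.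

Lemma size_box n : size (box n) = (n.*2.+1 ^ d)%N.
Proof. by rewrite size_codom card_ffun !card_ord. Qed.

Lemma mem_box n z : (z \in box n) = (mnorm z <= n)%N.
Proof.
rewrite le_mnorm; apply/codomP/forallP => [[f ->] i|h].
  rewrite mxE; move: (f i) => [k /= kn]; move: kn; rewrite -muln2; lia.
have hlt (i : 'I_d) : (absz (z 0%R i + n%:Z)%R < n.*2.+1)%N.
  by move: (h i); move: (z 0%R i) => t; rewrite -muln2; lia.
exists [ffun i => Ordinal (hlt i)]; apply/rowP => i; rewrite !mxE ffunE /=.
by move: (h i); move: (z 0%R i) => t; lia.
Qed.

Lemma box_opp n : perm_eq (map -%R (box n)) (box n).
Proof.
apply: uniq_perm; [by rewrite (map_inj_uniq (@oppr_inj _)) box_uniq|exact: box_uniq|].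
move=> z; rewrite -[z in LHS]opprK mem_map; last exact: oppr_inj.
by rewrite !mem_box mnormN.
Qed.

Lemma box_cover x : exists n, cell_of x \in box n.
Proof. by exists (mnorm (cell_of x)); rewrite mem_box. Qed.

Lemma cube_box k : exists n, forall x, cube k x -> cell_of x \in box n.
Proof.
exists (k * d.+1).+1 => x h; rewrite mem_box le_mnorm; apply/forallP => i.
have /cellP/(_ i) : cell (cell_of x) x by [].
have := h i.
have -> : x 0 i = delta * (x 0 i / delta) by rewrite mulrC divfK// gt_eqF// delta_gt0.
set t := x 0 i / delta; set z := cell_of x 0 i.
have k1 : k%:R = delta * (k * d.+1)%:R :> R.
  by rewrite /delta natrM mulrCA mulVf ?mulr1// pnatr_eq0.
rewrite k1 -mulrN !(ler_pM2l delta_gt0, ltr_pM2l delta_gt0) intrD.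
move=> /andP[h1 h2] /andP[h3 h4].
have : (z%:~R < (k * d.+1)%:Z%:~R :> R) by rewrite -pmulrn; lra.
have : ((- (k * d.+1)%:Z - 1)%:~R < z%:~R :> R) by rewrite intrD mulrNz -pmulrn; lra.
rewrite !ltr_int; lia.
Qed.

Lemma count_le_mnorm n k : (count (fun w => mnorm w <= k)%N (box n) <= k.*2.+1 ^ d)%N.
Proof.
rewrite -size_filter -size_box; apply: uniq_leq_size; first by rewrite filter_uniq ?box_uniq.
by move=> z; rewrite mem_filter !mem_box => /andP[].
Qed.

Lemma count_eq_mnorm n k : (count (fun w => mnorm w == k.+1)%N (box n) + k.*2.+1 ^ d
  <= k.+1.*2.+1 ^ d)%N.
Proof.
rewrite -size_filter -!size_box -size_cat; apply: uniq_leq_size.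
  rewrite cat_uniq filter_uniq ?box_uniq//= andbT; apply/hasPn => z.
  by rewrite mem_filter !mem_box => zk; apply/negP => /andP[/eqP]; lia.
by move=> z; rewrite mem_cat mem_filter !mem_box => /orP[/andP[/eqP -> //]|]; lia.
Qed.

(** A discrete mean value inequality. With m = 2k + 1 it bounds the number of lattice points between
    two consecutive boxes. *)
Lemma expn_diff m e : ((m + 2) ^ e <= m ^ e + 2 * e * (m + 2) ^ e.-1)%N.
Proof.
elim: e => [|e ih]; first by rewrite !expn0.
rewrite expnSr; apply: leq_trans (leq_mul ih (leqnn _)) _ => /=.
have hm : (m ^ e <= (m + 2) ^ e)%N by case: (e) => // e'; rewrite leq_exp2r// leq_addr.
case: e ih hm => [|e] ih hm; first by rewrite !expn0 /=; lia.
rewrite /= in ih *; rewrite !expnSr in hm *; nia.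
Qed.

Lemma count_shell n k : (count (fun w => mnorm w == k.+1)%N (box n) <=
  2 * d * k.+1.*2.+1 ^ d.-1)%N.
Proof.
have := count_eq_mnorm n k; have := expn_diff k.*2.+1 d.
rewrite (_ : k.*2.+1 + 2 = k.+1.*2.+1)%N; lia.
Qed.

Lemma sum_box_mnorm n (g : nat -> R) : (forall k, 0 <= g k) ->
  \sum_(z <- box n) g (mnorm z) <= g 0%N + \sum_(0 <= k < n) (2 * d * k.+1.*2.+1 ^ d.-1)%:R * g k.+1.
Proof.
move=> g0.
have -> : \sum_(z <- box n) g (mnorm z) = \sum_(0 <= k < n.+1) (count (fun w => mnorm w == k) (box n))%:R * g k.
  transitivity (\sum_(z <- box n) \sum_(0 <= k < n.+1) (mnorm z == k)%:R * g k).
    rewrite big_seq [RHS]big_seq; apply: eq_bigr => z; rewrite mem_box => zn.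
    rewrite (bigD1_seq (mnorm z)) ?iota_uniq ?mem_index_iota//= eqxx mul1r big1 ?addr0//.
    by move=> k /negbTE; rewrite eq_sym => ->; rewrite mul0r.
  rewrite exchange_big; apply: eq_bigr => k _.
  by rewrite -mulr_suml -sum1_count natr_sum [in RHS]big_mkcond; congr (_ * _);
    apply: eq_bigr => z _; case: eqP.
rewrite big_nat_recl//; apply: lerD.
  rewrite -[leRHS]mul1r ler_wpM2r// lern1.
  have := count_le_mnorm n 0; rewrite exp1n; apply: leq_trans.
  by apply: sub_count => z /= /eqP ->.
by apply: ler_sum => k _; rewrite ler_wpM2r// ler_nat count_shell.
Qed.

(** In a coordinate where [mnorm u] is attained, points of half-open intervals n steps apart differ
    by at least n - 1 steps. For [mnorm u = 0] the truncated predecessor makes the bound trivial. *)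
Lemma cell_dist u x y : cell 0 y -> cell u (x + y) -> delta * (mnorm u).-1%:R <= enorm x.
Proof.
move=> /cellP hy /cellP hxy; have e0 : 0 <= enorm x by rewrite sqrtr_ge0.
have [->|u0] := posnP (mnorm u); first by rewrite mulr0.
have [i ui] := mnorm_attained u0.
apply: le_trans (coord_le_enorm x i).
have := hy i; have := hxy i; rewrite !mxE mulr0 add0r mulr1 intrD mulrDr mulr1.
rewrite ui in u0 *; have -> : ((absz (u 0 i)).-1%:R : R) = `|(u 0 i)%:~R| - 1.
  by rewrite -intr_norm -natr_absz -subn1 natrB.
move=> /andP[h1 h2] /andP[h3 h4].
rewrite mulrBr mulr1 -[X in X * `|_|](gtr0_norm delta_gt0) -normrM.
by have [h|h] := leP 0 (delta * (u 0 i)%:~R); rewrite ?(ger0_norm h) ?(ltr0_norm h);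
  have := ler_norm (x 0 i); have := ler_norm (- x 0 i); rewrite normrN; lra.
Qed.

(* Contains every displacement carrying a point of [cell z] into [cell 0]. *)
Definition near_cell (z : Z) : set X := [set x | forall i, `|x 0 i + delta * (z 0 i)%:~R| < delta].

Lemma measurable_near_cell z : measurable (near_cell z).
Proof.
have := @measurable_coordset R d
  (fun i => `](- delta - delta * (z 0 i)%:~R), (delta - delta * (z 0 i)%:~R)[%classic)
  (fun=> measurable_itv _).
congr measurable; apply/seteqP; split => x /= h i; have := h i;
  rewrite /= ?in_itv /= ltr_norml; lra.
Qed.

Lemma near_cellP z x y : cell z y -> cell 0 (x + y) -> near_cell z x.
Proof.
move=> /cellP hy /cellP hxy i; have := hy i; have := hxy i.
by rewrite !mxE mulr0 add0r mulr1 intrD mulrDr mulr1 ltr_norml; lra.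
Qed.

Lemma near_cell_mnorm z x : near_cell z x -> delta * (mnorm z)%:R <= enorm x + delta.
Proof.
move=> hz; have e0 : 0 <= enorm x by rewrite sqrtr_ge0.
have dg := delta_gt0.
have [->|u0] := posnP (mnorm z); first by rewrite mulr0 addr_ge0// ltW.
have [i ui] := mnorm_attained u0.
rewrite ui natr_absz intr_norm -[X in X * `|_|](gtr0_norm delta_gt0) -normrM.
have := hz i; have := coord_le_enorm x i.
have := ler_normB (x 0 i + delta * (z 0 i)%:~R) (x 0 i).
rewrite addrAC subrr add0r; lra.
Qed.

(** Each coordinate of [z] has only two possible values, minus the floor of the rescaled coordinate
    of [x] or one less; [g] lists these choices. *)
Lemma count_near_cell n x : (count (fun z => `[< near_cell z x >]) (box n) <= 2 ^ d)%N.
Proof.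
pose g (f : {ffun 'I_d -> bool}) : Z := \row_i (- cell_of x 0 i - (f i : nat)%:Z).
rewrite -size_filter; apply: (@leq_trans (size (codom g))); last first.
  by rewrite size_codom card_ffun card_bool card_ord.
apply: uniq_leq_size; first by rewrite filter_uniq ?box_uniq.
move=> z; rewrite mem_filter => /andP[/asboolP h _]; apply/codomP.
exists [ffun i => z 0 i != - cell_of x 0 i]; apply/rowP => i; rewrite mxE ffunE.
have /cellP/(_ i) : cell (cell_of x) x by [].
have := h i.
have -> : x 0 i = delta * (x 0 i / delta) by rewrite mulrC divfK// gt_eqF// delta_gt0.
set t := x 0 i / delta; rewrite -mulrDr normrM (gtr0_norm delta_gt0).
rewrite -[X in _ < X]mulr1 !(ler_pM2l delta_gt0, ltr_pM2l delta_gt0).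
set c := cell_of x 0 i; set m := z 0 i => h1 h2.
have : (m%:~R < (1 - c)%:~R :> R).
  by rewrite intrB; move: h1 h2; rewrite ltr_norml intrD; lra.
have : ((- c - 2)%:~R < m%:~R :> R).
  by rewrite intrB mulrNz; move: h1 h2; rewrite ltr_norml intrD; lra.
rewrite !ltr_int; case: eqP => /=; lia.
Qed.

End cells.

(** * Log-dominating weights *)

Section log_dominating.
Context {R : realType}.
Variables (rho : R -> R) (hrho : strongly_log_dominating rho).

Let rho_ge0 r : 0 <= r -> 0 <= rho r. Proof. by have [h _ _] := hrho; exact: h. Qed.

Let rho_le r s : 0 <= r -> r <= s -> rho r <= rho s.
Proof. by have [_ h _] := hrho; exact: h. Qed.

Let g (r : R) : R := (r * rho r + 1)^-1.

Let g_ge0 r : 0 <= r -> 0 <= g r.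
Proof. by move=> r0; rewrite invr_ge0 addr_ge0// mulr_ge0// rho_ge0. Qed.

Let le_rrho r s : 0 <= r -> r <= s -> r * rho r <= s * rho s.
Proof. by move=> r0 rs; rewrite ler_pM// ?rho_ge0// rho_le. Qed.

Let g_le r s : 0 <= r -> r <= s -> g s <= g r.
Proof.
move=> r0 rs; have s0 := le_trans r0 rs.
rewrite lef_pV2 ?posrE ?ltr_wpDl// ?mulr_ge0 ?rho_ge0//.
by rewrite lerD2r le_rrho.
Qed.

(** The integral test for the nonincreasing function [g]. *)
Lemma log_dominating_sum (e : R) : 0 < e ->
  exists A : R, forall n, \sum_(1 <= j < n) g (e * j%:R) <= A.
Proof.
move=> e0; have [_ _ hI] := hrho.
set I := (\int[_]_(_ in _) _)%E in hI.
exists (fine I / e) => n; rewrite ler_pdivlMr//.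
(* On each interval the value at the right endpoint is used, so the step function stays below
   [g]. *)
pose F j := `[e * j.-1%:R, e * j%:R[%classic : set R.
pose f (r : R) := \sum_(j <- index_iota 1 n) g (e * j%:R) * \1_(F j) r.
have ej j : 0 <= e * j%:R by rewrite mulr_ge0// ltW.
have mE (r : R) : 0 <= r -> f r <= g r.
  move=> r0; apply: sum_disjoint_indic.
  - exact: iota_uniq.
  - move=> i j; rewrite !mem_index_iota => /andP[i1 _] /andP[j1 _].
    rewrite /F /= !in_itv /= => /andP[a1 a2] /andP[b1 b2].
    have := le_lt_trans a1 b2; have := le_lt_trans b1 a2.
    rewrite !ltr_pM2l// !ltr_nat; lia.
  - exact: g_ge0.
  - move=> j _; rewrite /F /= in_itv /= => /andP[_ /ltW rj]; exact: g_le.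
have I0 : (0 <= I)%E.
  by apply: integral_ge0 => r; rewrite /= in_itv /= andbT => r0; rewrite lee_fin g_ge0.
rewrite -lee_fin fineK ?ge0_fin_numE// mulr_suml -sumEFin.
apply: (@le_trans _ _ (\int[lebesgue_measure]_r (f r)%:E)%E); last first.
  rewrite /I [leRHS]integral_mkcond; apply: le_integral_lower => //= r.
    by rewrite lee_fin sumr_ge0// => j _; rewrite mulr_ge0// ?g_ge0// indicE.
  have [r0|r0] := leP 0 r.
    by rewrite patchE mem_set ?lee_fin ?mE//= in_itv /= andbT.
  rewrite patchE memNset /= ?in_itv /= ?andbT; last by apply/negP; rewrite -ltNge.
  (* Off the half-line the restricted integrand takes the default value [point], which is 0 here. *)
  rewrite (_ : point = 0%E)// lee_fin /f big1// => j _.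
  rewrite indicE memNset ?mulr0// /F /= in_itv /= => /andP[h _].
  by have := le_lt_trans h r0; rewrite ltNge mulr_ge0// ltW.
rewrite /f; under [leRHS]eq_integral do rewrite -sumEFin.
have mF j : measurable (F j : set (measurableTypeR R)) by exact: measurable_itv.
rewrite ge0_integral_sum//; last 2 first.
- move=> j; apply/measurable_EFinP; apply: measurable_funM => //.
- by move=> j r _; rewrite lee_fin mulr_ge0 ?g_ge0// indicE.
rewrite big_seq [leRHS]big_seq; apply: lee_sum => j; rewrite mem_index_iota => /andP[j1 _].
under eq_integral do rewrite EFinM.
rewrite ge0_integralZl//; last 2 first.
- by apply/measurable_EFinP.
- by rewrite lee_fin g_ge0.
have lF : lebesgue_measure (F j) = e%:E.
  rewrite /F lebesgue_measure_itv /= lte_fin ltr_pM2l// ltr_nat prednK// leqnn.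
  rewrite -EFinB -mulrBr -subn1 natrB// opprB.
  by rewrite addrC subrK mulr1.
have -> : (\int[lebesgue_measure]_x (\1_(F j) x)%:E = e%:E)%E.
  by rewrite integral_indic// setIT; exact: lF.
by rewrite -EFinM.
Qed.

(** Otherwise r rho(r) < 1 at arbitrarily large grid points, hence by monotonicity at all of them,
    and every term of the bounded sums would be at least 1/2. *)
Lemma log_dominating_large (e : R) : 0 < e ->
  exists J, forall j, (J <= j)%N -> 1 <= e * j%:R * rho (e * j%:R).
Proof.
move=> e0; have [A hA] := log_dominating_sum e0.
have ej j : 0 <= e * j%:R by rewrite mulr_ge0// ltW.
apply: contrapT => /forallNP h.
have gj j : 1 / 2 <= g (e * j%:R).
  have /existsNP[k /not_implyP[jk /negP]] := h j; rewrite -ltNge => k1.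
  have := le_rrho (ej j) (_ : e * j%:R <= e * k%:R).
  rewrite ler_pM2l// ler_nat => /(_ jk) h2.
  have h3 : 0 <= e * j%:R * rho (e * j%:R) by rewrite mulr_ge0// rho_ge0.
  rewrite div1r lef_pV2 ?posrE ?ltr_wpDl//.
  lra.
(* The sum has more than 2|A| terms, each at least 1/2. *)
have := hA ((Num.truncn (2 * `|A|)).+1.+1); apply/negP; rewrite -ltNge.
apply: (@lt_le_trans _ _ (\sum_(1 <= j < (Num.truncn (2 * `|A|)).+2) 1 / 2)); last first.
  by apply: ler_sum => j _; exact: gj.
rewrite big_const_nat iter_addr addr0 -[ltRHS]mulr_natl subn1 /= div1r ltr_pdivlMr// mulrC.
apply: (@le_lt_trans _ _ (2 * `|A|)); first by rewrite ler_wpM2l// ler_norm.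
exact: truncnS_gt.
Qed.

(* There are O(j^(d-1)) indices in the shell mnorm z = j, which turns the summand
   1 / (r^d rho(r) + 1) into O(1 / (r rho(r) + 1)), at least once r rho(r) >= 1. *)
Lemma log_dominating_box (d : nat) : (0 < d)%N -> exists A : R, forall n,
  \sum_(z <- @box d n) ((@delta R d * (mnorm z).-1%:R) ^+ d *
     rho (@delta R d * (mnorm z).-1%:R) + 1)^-1 <= A.
Proof.
move=> d0; set e := @delta R d; have e0 : 0 < e := delta_gt0.
have [A hA] := log_dominating_sum e0; have [J0 hJ] := log_dominating_large e0.
(* The successor ensures that indices from [J] on are positive. *)
pose J := J0.+1.
have ej j : 0 <= e * j%:R by rewrite mulr_ge0// ltW.
pose w (k : nat) := ((e * k%:R) ^+ d * rho (e * k%:R) + 1)^-1.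
have w0 k : 0 <= w k by rewrite invr_ge0 addr_ge0// mulr_ge0 ?exprn_ge0 ?rho_ge0.
have w1 k : w k <= 1.
  by rewrite invf_le1 ?ltr_wpDl ?mulr_ge0 ?exprn_ge0 ?rho_ge0// lerDr mulr_ge0 ?exprn_ge0 ?rho_ge0.
pose c (k : nat) : R := (2 * d * k.+1.*2.+1 ^ d.-1)%:R.
(* For j >= 1 one has 2j + 3 <= 5j = (5/e) t with t = e j, which bounds the shell count; the last
   factor 2 comes from t rho(t) + 1 <= 2 t rho(t). *)
pose C : R := (2 * d)%:R * (5 / e) ^+ d.-1 * 2.
have C0 : 0 <= C by rewrite !mulr_ge0// exprn_ge0// divr_ge0// ltW.
have big j : (J <= j)%N -> c j * w j <= C * g (e * j%:R).
  move=> Jj; have j0 : (0 < j)%N by exact: leq_trans Jj.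
  have h1 := hJ j (ltnW Jj).
  set t := e * j%:R in h1 *; have t0 : 0 < t by rewrite mulr_gt0// ltr0n.
  have rt : 0 <= rho t by rewrite rho_ge0// ltW.
  have cj : c j <= (2 * d)%:R * ((5 / e) ^+ d.-1 * t ^+ d.-1).
    rewrite /c natrM ler_wpM2l// natrX -exprMn lerXn2r ?nnegrE//.
      by rewrite mulr_ge0// ?divr_ge0// ltW.
    rewrite /t mulrA divfK ?gt_eqF// -natrM ler_nat -muln2; lia.
  have tw : t ^+ d.-1 * w j <= 2 * g t.
    have tw0 : 0 <= t ^+ d * rho t by rewrite mulr_ge0// exprn_ge0// ltW.
    have tr0 : 0 <= t * rho t by rewrite mulr_ge0// ltW.
    rewrite /w -/t ler_pdivrMr ?ltr_wpDl//.
    rewrite /g mulrAC ler_pdivlMr ?ltr_wpDl//.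
    rewrite -[in t ^+ d](prednK d0) exprSr -mulrA.
    have : 0 <= t ^+ d.-1 by rewrite exprn_ge0// ltW.
    move: (t ^+ d.-1) h1 => p; set q := t * rho t; nra.
  apply: (@le_trans _ _ ((2 * d)%:R * ((5 / e) ^+ d.-1 * t ^+ d.-1) * w j)).
    by rewrite ler_wpM2r.
  by rewrite /C -!mulrA ler_wpM2l// ler_wpM2l// exprn_ge0// divr_ge0//; exact: ltW.
exists (1 + (\sum_(0 <= k < J) c k + C * A)) => n.
(* The shell [mnorm z = k + 1], counted by [c k], receives the weight [w k], in accordance with the
   predecessor in the statement. *)
have := @sum_box_mnorm R d n (fun k => w k.-1); rewrite -/e => /(_ (fun k => w0 _)) h.
apply: le_trans h _; apply: lerD; first exact: w1.
rewrite /=; have c0 k : 0 <= c k by rewrite ler0n.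
apply: (@le_trans _ _ (\sum_(0 <= k < J + n) c k * w k)).
  rewrite [leRHS](big_cat_nat (n := n)) ?leq_addl//= lerDl sumr_ge0// => k _.
  by rewrite mulr_ge0.
rewrite (big_cat_nat (n := J)) ?leq_addr//=; apply: lerD.
  by apply: ler_sum => k _; rewrite -[leRHS]mulr1 ler_wpM2l.
apply: (@le_trans _ _ (\sum_(J <= k < J + n) C * g (e * k%:R))).
  by rewrite big_nat [leRHS]big_nat; apply: ler_sum => k /andP[? _]; exact: big.
rewrite -mulr_sumr ler_wpM2l//; apply: le_trans (hA (J + n)%N).
by rewrite [leRHS](big_cat_nat (n := J)) ?leq_addr//= lerDr sumr_ge0// => k _; rewrite g_ge0.
Qed.

End log_dominating.

(** * Restricted measures and squares of extended reals *)

Lemma integral_mrestr {d} {T : measurableType d} {R : realType}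
    (m : {measure set T -> \bar R}) (C : set T) (mC : measurable C) (f : T -> \bar R) :
  (forall x, 0 <= f x)%E -> measurable_fun setT f ->
  (\int[mrestr m mC]_x f x = \int[m]_(x in C) f x)%E.
Proof.
move=> f0 mf; rewrite -(setUv C) ge0_integral_setU//; last 3 first.
- exact: measurableC.
- by rewrite setUv.
- by apply/disj_setPCl.
rewrite [X in (_ + X)%E](_ : _ = 0%E) ?adde0.
  by apply: eq_measure_integral => A mA AC /=; rewrite /mrestr setIidl.
rewrite (eq_measure_integral mzero) ?integral_measure_zero// => A mA AC /=.
rewrite /mrestr (_ : A `&` C = set0) ?measure0//.
by apply/seteqP; split => // x [/AC].
Qed.

Lemma sqe_le {R : realType} (x y : \bar R) : (0 <= x -> x <= y -> x ^+ 2 <= y ^+ 2)%E.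
Proof. by move=> x0 xy; rewrite !expe2 lee_pmul. Qed.

Lemma sqeD_le {R : realType} (x y : \bar R) : (0 <= x -> 0 <= y ->
  (x + y) ^+ 2 <= 2%:E * (x ^+ 2 + y ^+ 2))%E.
Proof.
have oo (z : \bar R) : (0 <= z -> z <= 2%:E * (+oo + z))%E.
  by move=> z0; rewrite addye ?gt0_muley ?leey ?lte_fin// gt_eqF// (lt_le_trans _ z0).
rewrite !expe2; move: x y => [x| |] [y| |]// x0 y0.
- have : ((x + y) * (x + y) <= 2 * (x * x + y * y))%R.
    rewrite -subr_ge0 (_ : (_ - _ = (x - y) ^+ 2)%R) ?sqr_ge0//; ring.
  by rewrite -lee_fin.
- by rewrite mulyy addey// gt0_muley ?lte_fin ?leey.
- by rewrite mulyy addye// gt0_muley ?lte_fin ?leey.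
- by rewrite mulyy addye// gt0_muley ?lte_fin ?leey.
Qed.

(** Iterating the two-term inequality gives a crude constant; it is applied to a fixed box, where
    only finiteness matters. *)
Lemma sqe_sum_le {R : realType} (I : Type) (s : seq I) (x : I -> \bar R) :
  (forall i, 0 <= x i)%E ->
  ((\sum_(i <- s) x i) ^+ 2 <= (2 ^+ size s)%:E * \sum_(i <- s) x i ^+ 2)%E.
Proof.
move=> x0; elim: s => [|i s ih]; first by rewrite !big_nil expe2 mule0 mule0.
have x2 j : (0 <= x j ^+ 2)%E by exact: expe_ge0.
have s2 : (0 <= \sum_(j <- s) x j ^+ 2)%E by exact: sume_ge0.
rewrite !big_cons; apply: le_trans (sqeD_le _ _) _; [exact: x0|exact: sume_ge0|].
rewrite -[size _]/((size s).+1) exprS EFinM -muleA lee_wpmul2l ?lee_fin// ge0_muleDr//.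
apply: leeD; last exact: ih.
by rewrite -[leLHS]mul1e lee_wpmul2r// -[1%E]/(1%:E) lee_fin exprn_ege1// ler1n.
Qed.

Lemma measure_bigsetU_le {dT} {T : measurableType dT} {R : realType}
    (m : {measure set T -> \bar R}) {I : Type} (s : seq I) (F : I -> set T) :
  (forall i, measurable (F i)) ->
  (m (\big[setU/set0]_(i <- s) F i) <= \sum_(i <- s) m (F i))%E.
Proof.
move=> mF; elim: s => [|i s ih]; first by rewrite !big_nil measure0.
rewrite !big_cons; apply: le_trans (measureU2 _ _ _) _ => //.
  by apply: bigsetU_measurable.
by rewrite leeD2l.
Qed.

(** * Measurability of integrals against a kernel *)

Section kernel_measurability.
Local Open Scope ereal_scope.
Context {R : realType} {d1 d2} {T : measurableType d1} {Y : measurableType d2}.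
Variable m : T -> {measure set Y -> \bar R}.
Import HBNNSimple.
Hypothesis mm : forall B, measurable B -> measurable_fun setT (fun w => m w B).

(** Restricting to [C] makes each measure finite, with a bound that may depend on w. Sections of
    measurable sets then have measurable measure, and simple functions approximate [f]. *)
Lemma measurable_kernel_integral (C : set Y) (f : T * Y -> \bar R) : measurable C ->
  (forall w, m w C < +oo) -> (forall p, 0 <= f p) -> measurable_fun setT f ->
  measurable_fun setT (fun w => \int[m w]_(x in C) f (w, x)).
Proof.
move=> mC Cfin f0 mf.
pose k : R.-ker T ~> Y := HB.pack m (isKernel.Build _ _ _ _ _ m mm).
rewrite (_ : (fun w => _) = (fun w => \int[mrestr (m w) mC]_x f (w, x))); last first.
  apply/funext => w; rewrite integral_mrestr//.
  exact: measurableT_comp mf (pair1_measurable w).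
pose f_ := nnsfun_approx measurableT mf.
apply: (@measurable_fun_xsection_integral _ _ _ _ _ f (fun w => mrestr (m w) mC) f_).
- by move=> a b ab; exact/nd_nnsfun_approx.
- by move=> z; apply: cvg_nnsfun_approx.
- move=> n r.
  have bd w : exists M, forall S, measurable S -> mrestr (m w) mC S < M%:E.
    exists (fine (m w C) + 1)%R => S mS.
    apply: (@le_lt_trans _ _ (m w C)).
      by rewrite /mrestr le_measure ?inE//; exact: measurableI.
    by rewrite -[ltLHS]fineK ?ge0_fin_numE// lte_fin ltrDl.
  have mS : measurable (f_ n @^-1` [set r]) by [].
  exact: (@measurable_prod_subset_xsection_kernel _ _ _ _ _ k C mC bd _ mS).2.
Qed.

End kernel_measurability.

(** * Translations *)

Section shift.
Context {R : realType} {d : nat}.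
Local Notation X := 'rV[R]_d.
Local Open Scope ereal_scope.

Lemma translate0 (B : set X) : translate B 0 = B.
Proof. by rewrite translateE oppr0; apply/seteqP; split => x; rewrite /preimage /= addr0. Qed.

Lemma translateD (B : set X) a b : translate (translate B a) b = translate B (a + b)%R.
Proof.
by rewrite !translateE; apply/seteqP; split => x; rewrite /preimage /= opprD addrA addrAC.
Qed.

Lemma bounded_translate (B : set X) a : bounded_borel B -> bounded_borel (translate B a).
Proof.
move=> [mB [r Br]]; have [k rk] := @eball_cube R d r; split; first exact: measurable_translate.
have [l al] := @eball_cube R d (enorm a + 1).
have {}al : cube l a by apply: al; rewrite /eball /= ltrDl.
have [_ [s hs]] := @bounded_cube R d (k + l).
exists s => _ [y /Br /rk yk <-]; apply: hs => i.
have := yk i; have := al i; rewrite !mxE natrD; lra.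
Qed.

Lemma jordan_plus_translate (s s' : set X -> R) a B :
  (forall A, bounded_borel A -> s A = s' (translate A a)) ->
  jordan_plus s B = jordan_plus s' (translate B a).
Proof.
move=> ss'; rewrite /jordan_plus; congr ereal_sup; apply/seteqP; split => _ [A [bA AB] <-].
  exists (translate A a); last by rewrite ss'.
  split; first exact: bounded_translate.
  by move=> _ [x Ax <-]; exists x => //; exact: AB.
exists (translate A (- a)%R).
  split; first exact: bounded_translate.
  by move=> _ [x /AB[y By <-] <-]; rewrite addrK.
by rewrite ss' ?translateD ?addNr ?translate0//; exact: bounded_translate.
Qed.

Lemma mvar_translate (nu nu' : cmeasure R d) a B :
  (forall A, bounded_borel A -> nu A = nu' (translate A a)) ->
  mvar nu B = mvar nu' (translate B a).
Proof.
move=> h; have hk k : jpart nu k B = jpart nu' k (translate B a).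
  by apply: jordan_plus_translate => A /h nuA; rewrite /cpart nuA.
by rewrite !mvarE !hk.
Qed.

End shift.

(** * Mass transport between cells *)

Section transport.
Local Open Scope ereal_scope.
Context {R : realType} {d : nat} {dT : measure_display} {T : measurableType dT}.
Local Notation X := 'rV[R]_d.
Variable P : probability T R.
Variables (theta : X -> T -> T) (htheta : measurable_flow theta) (hP : preserves P theta).
Variables (Phi : T -> cmeasure R d) (K : T -> X -> fcmeasure R d).
Hypotheses (hPhi : random_cmeasure Phi) (Phi_inv : cmeasure_invariant theta Phi).
Hypotheses (hK : transport_kernel K) (K_inv : kernel_invariant theta K).

Lemma measurable_flow_at a : measurable_fun setT (theta a).
Proof.
have [_ _ h] := htheta; exact: measurableT_comp h (pair2_measurable a).
Qed.

Lemma integral_flow a (f : T -> \bar R) : measurable_fun setT f -> (forall w, 0 <= f w) ->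
  \int[P]_w f (theta a w) = \int[P]_w f w.
Proof.
move=> mf f0; have mt := measurable_flow_at a.
rewrite -[LHS](@ge0_integral_pushforward _ _ _ _ _ (theta a) mt P setT f)//.
by apply: eq_measure_integral => A mA _; exact: hP.
Qed.

(** With two cells as arguments this is N(z,u), built from [mvar] on both levels so that additivity
    and Tonelli apply. *)
Definition mass (w : T) (A B : set X) : \bar R :=
  \int[mvar (Phi w)]_(x in A) mvar (K w x) B.

Lemma measurable_mvarK (B : set X) : measurable B ->
  measurable_fun setT (fun p : T * X => mvar (K p.1 p.2) B).
Proof.
by move=> mB; apply: (measurable_mvar (Phi := fun p : T * X => K p.1 p.2 : cmeasure R d)).
Qed.

Lemma measurable_mvarK_at w (B : set X) : measurable B ->
  measurable_fun setT (fun x => mvar (K w x) B).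
Proof.
by move=> mB; apply: (measurableT_comp (measurable_mvarK mB) (pair1_measurable w)).
Qed.

Lemma measurable_mvarPhi B : measurable B -> measurable_fun setT (fun w => mvar (Phi w) B).
Proof. by move=> mB; exact: measurable_mvar. Qed.

Lemma mass_ge0 w A B : 0 <= mass w A B.
Proof. exact: integral_ge0. Qed.

Lemma measurable_mass A B : bounded_borel A -> measurable B ->
  measurable_fun setT (fun w => mass w A B).
Proof.
move=> bA mB; apply: (@measurable_kernel_integral _ _ _ _ _ (fun w => mvar (Phi w))
  _ A (fun p => mvar (K p.1 p.2) B)) => //.
- by move=> C mC; exact: measurable_mvarPhi.
- exact: bA.1.
- by move=> w; exact: mvar_bounded.
- exact: measurable_mvarK.
Qed.

(** Invariance makes the variation of Phi at [theta a w] the pushforward of that at [w] under x -> x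
    - a. After this change of variables the invariance of the kernel moves the target set. *)
Lemma mass_shift a w A B : measurable A -> measurable B ->
  mass (theta a w) A B = mass w (translate A a) (translate B a).
Proof.
move=> mA mB; rewrite /mass.
have mphi : measurable_fun setT (fun x : X => x - a)%R by exact: measurable_shift.
rewrite (eq_measure_integral (pushforward (mvar (Phi w)) (fun x : X => x - a)%R)); last first.
  move=> S mS _ /=; rewrite /pushforward -(translateE S); apply: mvar_translate => C bC.
  exact: Phi_inv.
rewrite ge0_integral_pushforward//; last first.
  by apply: measurable_funS (measurable_mvarK_at _ mB).
rewrite -(translateE A); apply: eq_integral => x _ /=.
rewrite -(@mvar_translate _ _ (K (theta a w) (x - a)))// => C bC.
by rewrite K_inv// subrK.
Qed.

Definition big_box n : set X := [set x | cell_of x \in box n].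

Lemma big_boxE n : big_box n = \big[setU/set0]_(z <- box n) cell z.
Proof.
rewrite -bigcup_seq; apply/seteqP; split => x /=; first by move=> h; exists (cell_of x).
by case=> z /= zn xz; rewrite /big_box /= xz.
Qed.

Lemma bounded_big_box n : bounded_borel (big_box n).
Proof.
rewrite big_boxE; elim/big_ind : _ => [|A B|z _].
- exact: bounded_borel0.
- exact: bounded_borelU.
- exact: bounded_cell.
Qed.

Lemma le_big_box m n : (m <= n)%N -> big_box m `<=` big_box n.
Proof. by move=> mn x; rewrite /big_box /= !mem_box => /leq_trans; exact. Qed.

Lemma bigcup_big_box : \bigcup_n big_box n = setT.
Proof. by apply/seteqP; split => // x _; have [n] := box_cover x; exists n. Qed.

Lemma mass_box w n B : measurable B ->
  mass w (big_box n) B = \sum_(z <- box n) mass w (cell z) B.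
Proof.
move=> mB; rewrite /mass big_boxE ge0_integral_bigsetU//.
- by move=> z; exact: measurable_cell.
- exact: box_uniq.
- by move=> z v _ _ [x [/= <-]].
- by apply: measurable_funS (measurable_mvarK_at _ mB).
Qed.

Lemma mass_cvg w B : measurable B -> mass w (big_box n) B @[n --> \oo] --> mass w setT B.
Proof.
move=> mB; rewrite -bigcup_big_box; apply: ge0_nondecreasing_set_cvg_integral => //.
- by move=> m n mn; apply/subsetPset; exact: le_big_box.
- by move=> n; have [] := bounded_big_box n.
- by move=> n; apply: measurable_funS (measurable_mvarK_at _ mB).
Qed.

Lemma measurable_massT B : measurable B -> measurable_fun setT (fun w => mass w setT B).
Proof.
move=> mB; apply: (emeasurable_fun_cvg (fun n w => mass w (big_box n) B)).
- by move=> n; apply: measurable_mass => //; exact: bounded_big_box.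
- by move=> w _; exact: mass_cvg.
Qed.

Lemma le_mass w A A' B : measurable A -> measurable A' -> A `<=` A' -> measurable B ->
  mass w A B <= mass w A' B.
Proof.
move=> mA mA' AA' mB; apply: ge0_subset_integral => //.
by apply: measurable_funS (measurable_mvarK_at _ mB).
Qed.

Lemma massT_sq B (c : \bar R) : measurable B ->
  (forall n, \int[P]_w (mass w (big_box n) B ^+ 2) <= c) ->
  \int[P]_w (mass w setT B ^+ 2) <= c.
Proof.
move=> mB hc.
have ms n : measurable (big_box n) := (bounded_big_box n).1.
have nd w m n : (m <= n)%N -> mass w (big_box m) B ^+ 2 <= mass w (big_box n) B ^+ 2.
  move=> mn; apply: sqe_le; first exact: mass_ge0.
  by apply: le_mass => //; exact: le_big_box.
have e w : mass w setT B ^+ 2 = limn (fun n => mass w (big_box n) B ^+ 2).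
  apply/esym/cvg_lim => //; under eq_fun do rewrite expe2; rewrite expe2.
  apply: cvgeM; [|exact: mass_cvg|exact: mass_cvg].
  (* The product of the limits is well defined: a square is never zero times infinity. *)
  by rewrite /mule_def; case: (mass w setT B) => [r| |] //=; case: eqP.
have mq n : measurable_fun setT (fun w => mass w (big_box n) B ^+ 2).
  under eq_fun do rewrite expe2.
  by apply: emeasurable_funM; apply: measurable_mass => //; exact: bounded_big_box.
under eq_integral do rewrite e.
rewrite monotone_convergence//.
- apply: lime_le; last exact: nearW.
  apply: ereal_nondecreasing_is_cvgn => m n mn; apply: ge0_le_integral => //.
  + by move=> w _; rewrite expe_ge0// mass_ge0.
  + by move=> w _; exact: nd.
- by move=> n w _; rewrite expe_ge0// mass_ge0.
- by move=> w _ m n mn; exact: nd.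
Qed.

(** The common target of (a) and (b): it concerns one target cell and finitely many source cells,
    with a bound uniform in their number. *)
Hypothesis mass_sq : exists c : R, forall n,
  \int[P]_w (mass w (big_box n) (cell 0) ^+ 2) <= c%:E.

(** Shifting by [latt u] carries cell 0 to [cell u] and leaves the source, the whole space,
    unchanged. *)
Lemma massT_cell_sq u : \int[P]_w (mass w setT (cell u) ^+ 2) < +oo.
Proof.
have [c hc] := mass_sq.
have mc := @measurable_cell R d.
have -> : \int[P]_w (mass w setT (cell u) ^+ 2) = \int[P]_w (mass w setT (cell 0) ^+ 2).
  transitivity (\int[P]_w (mass (theta (latt u) w) setT (cell 0) ^+ 2)); last first.
    apply: (integral_flow (latt u) (f := fun w => mass w setT (cell 0) ^+ 2)).
    + under eq_fun do rewrite expe2.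
      by apply: emeasurable_funM; exact: measurable_massT.
    + by move=> w; rewrite expe_ge0// mass_ge0.
  apply: eq_integral => w _; rewrite mass_shift//.
  by rewrite cell_translate add0r translateE preimage_setT.
by apply: (@le_lt_trans _ _ c%:E); [exact: massT_sq|rewrite ltry].
Qed.

Lemma massT_big_box_sq n : \int[P]_w (mass w setT (big_box n) ^+ 2) < +oo.
Proof.
have mc := @measurable_cell R d.
have mS w : mass w setT (big_box n) <= \sum_(u <- box n) mass w setT (cell u).
  rewrite /mass -ge0_integral_sum//; last by move=> u; exact: measurable_mvarK_at.
  apply: le_integral_lower => // x; rewrite big_boxE.
  exact: measure_bigsetU_le.
apply: (@le_lt_trans _ _ ((2 ^+ size (@box d n))%:E *
    \sum_(u <- box n) \int[P]_w (mass w setT (cell u) ^+ 2))).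
  have m2 u : measurable_fun setT (fun w => mass w setT (cell u) ^+ 2).
    by under eq_fun do rewrite expe2; apply: emeasurable_funM; exact: measurable_massT.
  rewrite -ge0_integral_sum//; last by move=> u w _; rewrite expe_ge0// mass_ge0.
  rewrite -ge0_integralZl//; last 2 first.
  - by apply: emeasurable_sum => u.
  - by move=> w _; rewrite sume_ge0// => u _; rewrite expe_ge0// mass_ge0.
  apply: le_integral_lower => // w; first by rewrite expe_ge0// mass_ge0.
  apply: le_trans (sqe_sum_le _ _); last by move=> u; exact: mass_ge0.
  by apply: sqe_le; [exact: mass_ge0|exact: mS].
rewrite -ge0_fin_numE; last first.
  rewrite mule_ge0 ?lee_fin// sume_ge0// => u _; apply: integral_ge0 => w _.
  by rewrite expe_ge0// mass_ge0.
rewrite fin_numM// sum_fin_num; apply/allP => _ /mapP[u _ ->].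
rewrite /= ge0_fin_numE ?massT_cell_sq//; apply: integral_ge0 => w _.
by rewrite mule_ge0// mass_ge0.
Qed.

Lemma ae_mass_fin : {ae P, forall w, forall n, mass w setT (big_box n) < +oo}.
Proof.
apply/ae_foralln => n.
have mb : measurable (big_box n) := (bounded_big_box n).1.
have m2 : measurable_fun setT (fun w => mass w setT (big_box n) ^+ 2).
  by under eq_fun do rewrite expe2; apply: emeasurable_funM; exact: measurable_massT.
have i2 : P.-integrable setT (fun w => mass w setT (big_box n) ^+ 2).
  apply/integrableP; split => //.
  under eq_integral do rewrite gee0_abs ?expe_ge0 ?mass_ge0//.
  exact: massT_big_box_sq.
have := integrable_ae measurableT i2.
apply: filterS => w /(_ I); rewrite expe2.
have := mass_ge0 w setT (big_box n); case: (mass w setT (big_box n)) => [r _ _|_|//].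
  by rewrite ltry.
by rewrite mulyy.
Qed.

Lemma abs_kernel_apply_le w B : measurable B ->
  abs_kernel_apply K Phi w B <= mass w setT B.
Proof.
move=> mB; rewrite /abs_kernel_apply -[leRHS]mul1e.
apply: le_integral_setfun => //.
- exact: tv0.
- by move=> A mA; rewrite mul1e tv_le_mvar.
- by move=> x; exact: tv_ge0.
- by move=> x; exact: tv_le_mvar.
Qed.

(** A bounded set lies in some big box, and a variable with integrable square is almost surely
    finite. Countably many boxes give a single null set. *)
Lemma abs_kernel_apply_locally_finite :
  {ae P, forall w, locally_finite (abs_kernel_apply K Phi w)}.
Proof.
apply: filterS ae_mass_fin => w h B bB.
have [r Br] := bB.2; have [k rk] := @eball_cube R d r; have [n kn] := @cube_box R d k.
have mB := bB.1; have mb : measurable (big_box n) := (bounded_big_box n).1.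
apply: le_lt_trans (abs_kernel_apply_le w mB) _; apply: le_lt_trans (h n).
apply: ge0_le_integral => //.
- exact: measurable_mvarK_at.
- exact: measurable_mvarK_at.
- by move=> x _; apply: le_mvar => y /Br/rk/kn.
Qed.

End transport.

(** * Bounding complex integrals by the variation *)

Section complex_integral.
Local Open Scope ereal_scope.
Context {R : realType} {d : nat}.
Local Notation X := 'rV[R]_d.
Local Notation normc := (@ComplexField.Normc.normc R).

Lemma normc_le_addr (a b : R) : (normc (a +i* b)%C <= `|a| + `|b|)%R.
Proof.
have ab : (0 <= `|a| + `|b|)%R by rewrite addr_ge0.
rewrite /= -[leRHS](ger0_norm ab) -sqrtr_sqr ler_wsqrtr//.
rewrite (sqrrD `|a|) !real_normK ?num_real// lerD2r lerDl.
by rewrite mulrn_wge0// mulr_ge0.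
Qed.

Lemma ler_Re_normc (z : R[i]) : (`|complex.Re z| <= normc z)%R.
Proof. by case: z => a b /=; rewrite -sqrtr_sqr ler_wsqrtr// lerDl sqr_ge0. Qed.

Lemma ler_Im_normc (z : R[i]) : (`|complex.Im z| <= normc z)%R.
Proof. by case: z => a b /=; rewrite -sqrtr_sqr ler_wsqrtr// lerDr sqr_ge0. Qed.

Variables (nu : cmeasure R d) (f : X -> R[i]).

Let I := \int[mvar nu]_x (normc (f x))%:E.

Lemma normr_integral_jpart (k : nat) (h : X -> R) (i : R) : (k < 4)%N -> I = i%:E ->
  (forall x, `|h x| <= normc (f x))%R ->
  (`|fine (\int[jpart nu k]_x (h x)%:E)| <= i)%R.
Proof.
move=> k4 Ii hf.
have n0 x : (0 <= normc (f x))%R by rewrite normc_ge0.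
have jm A : measurable A -> jpart nu k A <= 1%:E * mvar nu A.
  by move=> mA; rewrite mul1e; exact: jpart_le_mvar.
have hp (e : X -> \bar R) : (forall x, 0 <= e x) -> (forall x, e x <= (normc (f x))%:E) ->
    0 <= \int[jpart nu k]_x e x <= i%:E.
  move=> e0 ef; rewrite integral_ge0//= -Ii -[leRHS]mul1e.
  by apply: le_integral_setfun.
rewrite integralE.
have /andP[p0 p1] : 0 <= \int[jpart nu k]_x ((EFin \o h) ^\+ x) <= i%:E.
  apply: hp => x; first exact: funepos_ge0.
  by rewrite funeposE/= -EFin_max lee_fin ge_max n0 (le_trans (ler_norm _) (hf x)).
have /andP[q0 q1] : 0 <= \int[jpart nu k]_x ((EFin \o h) ^\- x) <= i%:E.
  apply: hp => x; first exact: funeneg_ge0.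
  rewrite funenegE/= -EFin_max lee_fin ge_max n0.
  by rewrite (le_trans (ler_norm _))// normrN.
have pf : \int[jpart nu k]_x ((EFin \o h) ^\+ x) \is a fin_num.
  by rewrite ge0_fin_numE// (le_lt_trans p1) ?ltry.
have qf : \int[jpart nu k]_x ((EFin \o h) ^\- x) \is a fin_num.
  by rewrite ge0_fin_numE// (le_lt_trans q1) ?ltry.
rewrite fineB//.
have := fine_ge0 p0; have := fine_ge0 q0.
have : (fine (\int[jpart nu k]_x ((EFin \o h) ^\+ x)) <= i)%R by rewrite -lee_fin fineK.
have : (fine (\int[jpart nu k]_x ((EFin \o h) ^\- x)) <= i)%R by rewrite -lee_fin fineK.
rewrite ler_norml; lra.
Qed.

(** Four signed integrals occur, each a difference of two terms bounded by [I]: hence 8. When [I] is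
    infinite, where [fine] returns a default value, the bound is trivial. *)
Lemma normc_cintegral_le : (normc (cintegral nu f))%:E <= 8%:E * I.
Proof.
have I0 : 0 <= I by apply: integral_ge0 => x _; rewrite lee_fin normc_ge0.
have := leey I; rewrite le_eqVlt => /predU1P[->|Ioo].
  by rewrite gt0_muley ?leey ?lte_fin.
have Ii : I = (fine I)%:E by rewrite fineK// ge0_fin_numE.
rewrite Ii -EFinM lee_fin.
set i := fine I in Ii *.
have rek := fun x => ler_Re_normc (f x).
have imk := fun x => ler_Im_normc (f x).
apply: le_trans (normc_le_addr _ _) _.
have b (k l : nat) (h : X -> R) : (k < 4)%N -> (l < 4)%N -> (forall x, `|h x| <= normc (f x))%R ->
   (`|fine (\int[jpart nu k]_x (h x)%:E) - fine (\int[jpart nu l]_x (h x)%:E)| <= 2 * i)%R.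
  move=> k4 l4 hf; apply: le_trans (ler_normB _ _) _.
  by rewrite mulr2n mulrDl mul1r; apply: lerD; exact: normr_integral_jpart.
have h1 := b 0%N 1%N (fun x => complex.Re (f x)) isT isT rek.
have h2 := b 0%N 1%N (fun x => complex.Im (f x)) isT isT imk.
have h3 := b 2%N 3%N (fun x => complex.Re (f x)) isT isT rek.
have h4 := b 2%N 3%N (fun x => complex.Im (f x)) isT isT imk.
rewrite (_ : 8 * i = (2 * i + 2 * i) + (2 * i + 2 * i))%R; last by ring.
apply: lerD.
  by apply: le_trans (ler_normB _ _) _; apply: lerD; [exact: h1|exact: h4].
by apply: le_trans (ler_normD _ _) _; apply: lerD; [exact: h2|exact: h3].
Qed.

End complex_integral.

(** * From the second moment of the mass to K Phi *)

Section transport_conclusion.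
Local Open Scope ereal_scope.
Context {R : realType} {d : nat} {dT : measure_display} {T : measurableType dT}.
Local Notation X := 'rV[R]_d.
Variable P : probability T R.
Variables (theta : X -> T -> T) (htheta : measurable_flow theta) (hP : preserves P theta).
Variables (Phi : T -> cmeasure R d) (K : T -> X -> fcmeasure R d).
Hypotheses (hPhi : random_cmeasure Phi) (Phi_inv : cmeasure_invariant theta Phi).
Hypotheses (hK : transport_kernel K) (K_inv : kernel_invariant theta K).

(** Each set of a disjoint family contributes at most 8 times the mass it receives, and these masses
    add up inside [B]. *)
Lemma tv_kernel_apply_le w B : measurable B ->
  tv (kernel_apply K Phi w) B <= 8%:E * mass Phi K w setT B.
Proof.
move=> mB; apply: ge_ereal_sup => _ [n [A [hA tA ->]]].
have mA i : measurable (A i) by have [[]] := hA i.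
apply: (@le_trans _ _ (\sum_(i < n) 8%:E * mass Phi K w setT (A i))).
  rewrite -sumEFin; apply: lee_sum => i _; apply: le_trans (normc_cintegral_le _ _) _.
  rewrite lee_wpmul2l ?lee_fin//; apply: le_integral_lower => // x.
    by rewrite lee_fin normc_ge0.
  by apply: normc_le_mvar; have [] := hA i.
rewrite -ge0_sume_distrr; last by move=> i _; exact: mass_ge0.
rewrite lee_wpmul2l ?lee_fin// /mass -ge0_integral_sum//; last first.
  by move=> i; exact: measurable_mvarK_at.
apply: le_integral_lower => // x; first exact: sume_ge0.
by apply: sum_mvar_le => // i; have [[]] := hA i.
Qed.

Lemma transport_conclusion :
  (exists c : R, forall n, \int[P]_w (mass Phi K w (big_box n) (cell 0) ^+ 2) <= c%:E) ->
  {ae P, forall w, locally_finite (abs_kernel_apply K Phi w)} /\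
  loc_abs_sq_integrable P (kernel_apply K Phi).
Proof.
move=> h; split; first exact: (abs_kernel_apply_locally_finite htheta).
have [k rk] := @eball_cube R d 1; have [n kn] := @cube_box R d k.
have mb : measurable (@big_box R d n) := (bounded_big_box n).1.
rewrite /loc_abs_sq_integrable /loc_sq_integrable.
(* Here 64 is the square of the constant 8, and the unit ball lies in the big box. *)
apply: (@le_lt_trans _ _ (\int[P]_w (64%:E * (mass Phi K w setT (big_box n)) ^+ 2))).
  apply: le_integral_lower => // w; first by rewrite expe_ge0// tv_ge0.
  rewrite (_ : 64%:E * _ = (8%:E * mass Phi K w setT (big_box n)) ^+ 2).
    apply: sqe_le; first exact: tv_ge0.
    apply: le_trans (tv_kernel_apply_le _ mb).
    exact: (le_tv _ (subset_trans rk kn)).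
  rewrite !expe2 muleACA; congr (_ * _); rewrite -EFinM; congr EFin; ring.
rewrite ge0_integralZl_EFin//.
- rewrite lte_mul_pinfty//; exact: (massT_big_box_sq htheta hP hPhi).
- by move=> w _; rewrite expe_ge0// mass_ge0.
- by under eq_fun do rewrite expe2; apply: emeasurable_funM; exact: measurable_massT.
Qed.

End transport_conclusion.

(** * Weighted Cauchy-Schwarz inequality in the extended reals *)

Section ereal_sums.
Local Open Scope ereal_scope.
Context {R : realType}.

(** The cross term is handled by the arithmetic-geometric inequality for p = A c x^2 and q = B / c,
    since (x S)^2 <= x^2 A B = p q. *)
Lemma weighted_cauchy_step (x S A B c : R) : (0 <= x -> 0 <= S -> 0 <= A -> 0 <= B -> 0 < c ->
  S * S <= A * B -> (x + S) * (x + S) <= (c^-1 + A) * (c * (x * x) + B))%R.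
Proof.
move=> x0 S0 A0 B0 c0 SAB.
pose p := (A * c * (x * x))%R; pose q := (c^-1 * B)%R.
have p0 : (0 <= p)%R by rewrite !mulr_ge0// ltW.
have q0 : (0 <= q)%R by rewrite mulr_ge0// invr_ge0 ltW.
have pq : (p * q = x * x * (A * B))%R.
  rewrite /p /q (_ : A * c * (x * x) * (c^-1 * B) = (c * c^-1) * (x * x * (A * B)))%R; last by ring.
  by rewrite mulfV ?mul1r// gt_eqF.
have h : (2 * (x * S) <= p + q)%R.
  have h1 : (0 <= 2 * (x * S))%R by rewrite !mulr_ge0.
  rewrite -(@ler_pXn2r _ 2)// ?nnegrE// ?addr_ge0//.
  have h2 : (x * x * (S * S) <= p * q)%R by rewrite pq ler_wpM2l// mulr_ge0.
  have h3 := sqr_ge0 (p - q)%R.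
  rewrite -subr_ge0 (_ : ((p + q) ^+ 2 - (2 * (x * S)) ^+ 2 =
    (p - q) ^+ 2 + 4 * (p * q - x * x * (S * S)))%R); last by ring.
  by rewrite addr_ge0// mulr_ge0// subr_ge0.
rewrite (_ : ((c^-1 + A) * (c * (x * x) + B) = (c * c^-1) * (x * x) + (p + q) + A * B)%R); last by rewrite /p /q; ring.
rewrite mulfV ?mul1r ?gt_eqF//.
rewrite (_ : ((x + S) * (x + S) = x * x + 2 * (x * S) + S * S)%R); last by ring.
by rewrite lerD// lerD2l.
Qed.

Lemma weighted_cauchy (I : Type) (s : seq I) (c : I -> R) (x : I -> \bar R) :
  (forall i, (0 < c i)%R) -> (forall i, 0 <= x i) ->
  (\sum_(i <- s) x i) ^+ 2 <= (\sum_(i <- s) (c i)^-1)%:E * \sum_(i <- s) (c i)%:E * x i ^+ 2.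
Proof.
move=> c0 x0; elim: s => [|i s ih]; first by rewrite !big_nil expe2 !mule0.
have A0 : (0 <= \sum_(j <- s) (c j)^-1)%R by rewrite sumr_ge0// => j _; rewrite invr_ge0 ltW.
have B0 : 0 <= \sum_(j <- s) (c j)%:E * x j ^+ 2.
  by rewrite sume_ge0// => j _; rewrite mule_ge0 ?lee_fin ?expe_ge0// ltW.
have S0 : 0 <= \sum_(j <- s) x j by exact: sume_ge0.
rewrite !big_cons !expe2; rewrite expe2 in ih.
move: (\sum_(j <- s) (c j)^-1)%R (\sum_(j <- s) (c j)%:E * x j ^+ 2) (\sum_(j <- s) x j) A0 B0 S0 ih.
move=> A B S A0 B0 S0 ih.
have cA : (0 < (c i)^-1 + A)%R by rewrite ltr_wpDr// invr_gt0.
have top : ((c i)^-1 + A)%:E * +oo = +oo by rewrite gt0_muley ?lte_fin.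
have := x0 i; case: (x i) => [xr| |//] xr0; last first.
  rewrite addye; last by rewrite gt_eqF// (lt_le_trans _ S0).
  rewrite !mulyy gt0_muley ?lte_fin// addye ?top ?leey//.
  by rewrite gt_eqF// (lt_le_trans _ B0).
case: S S0 ih => [S| |//] S0 ih; last first.
  have -> : B = +oo.
    by case: B B0 ih => [B|//|//] B0; rewrite mulyy -EFinM leye_eq.
  by rewrite addey ?top ?leey.
case: B B0 ih => [B| |//] B0 ih; last by rewrite addey ?top ?leey.
rewrite -[leLHS]/(((xr + S) * (xr + S))%:E) -[leRHS]/((((c i)^-1 + A) * (c i * (xr * xr) + B))%:E).
by rewrite lee_fin; apply: weighted_cauchy_step; rewrite -?lee_fin.
Qed.

Lemma sum_sqe_le (I : Type) (s : seq I) (x : I -> \bar R) : (forall i, 0 <= x i) ->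
  \sum_(i <- s) x i ^+ 2 <= (\sum_(i <- s) x i) ^+ 2.
Proof.
move=> x0; elim: s => [|i s ih]; first by rewrite !big_nil expe2 !mule0.
have S0 : 0 <= \sum_(j <- s) x j by exact: sume_ge0.
rewrite !big_cons; apply: (@le_trans _ _ (x i ^+ 2 + (\sum_(j <- s) x j) ^+ 2)).
  by rewrite leeD2l.
rewrite !expe2 ge0_muleDl// !ge0_muleDr//.
by apply: leeD; [rewrite leeDl// mule_ge0|rewrite leeDr// mule_ge0].
Qed.

End ereal_sums.

(** * The log-dominating case *)

Section log_dominating_case.
Local Open Scope ereal_scope.
Context {R : realType} {d : nat} {dT : measure_display} {T : measurableType dT}.
Local Notation X := 'rV[R]_d.
Variable P : probability T R.
Variables (theta : X -> T -> T) (htheta : measurable_flow theta) (hP : preserves P theta).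
Variables (Phi : T -> cmeasure R d) (K : T -> X -> fcmeasure R d).
Hypotheses (hPhi : random_cmeasure Phi) (Phi_inv : cmeasure_invariant theta Phi).
Hypotheses (hK : transport_kernel K) (K_inv : kernel_invariant theta K).
Variables (rho : R -> R) (hrho : strongly_log_dominating rho) (hd : (0 < d)%N).
Hypothesis hW : loc_sq_integrable P (weighted_measure rho K Phi).

Let rho_ge0 r : (0 <= r)%R -> (0 <= rho r)%R. Proof. by have [h _ _] := hrho; exact: h. Qed.

Let wt (u : 'rV[int]_d) : R :=
  ((@delta R d * (mnorm u).-1%:R) ^+ d * rho (@delta R d * (mnorm u).-1%:R) + 1)%R.

Let r_ge0 (k : nat) : (0 <= @delta R d * k%:R)%R.
Proof. by rewrite mulr_ge0// ltW// delta_gt0. Qed.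

Let wt_ge1 u : (1 <= wt u)%R.
Proof. by rewrite lerDr mulr_ge0 ?exprn_ge0 ?rho_ge0. Qed.

Let wt_gt0 u : (0 < wt u)%R. Proof. exact: lt_le_trans (wt_ge1 u). Qed.

Lemma tv_kernel_star w y B : tv (kernel_star K w y) B = tv (K w y) (translate B y).
Proof.
apply/eqP; rewrite eq_le; apply/andP; split; apply: ereal_sup_le => _ [n [A [hA tA ->]]].
  exists n, (fun i => translate (A i) y); split => //.
    move=> i; have [bA AB] := hA i; split; first exact: bounded_translate.
    by move=> _ [x Ax <-]; exists x => //; exact: AB.
  move=> i j _ _ [_ [[a Aa <-] [b Ab /addIr ab]]]; apply: tA => //.
  by exists a; split => //; rewrite -ab.
have tAy i : translate (translate (A i) (- y)%R) y = A i.
  by rewrite translateD addNr translate0.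
exists n, (fun i => translate (A i) (- y)%R); split.
- move=> i; have [bA AB] := hA i; split; first exact: bounded_translate.
  by move=> _ [x /AB[b Bb <-] <-]; rewrite addrK.
- move=> i j _ _ [_ [[a Aa <-] [b Ab /addIr ab]]]; apply: tA => //.
  by exists a; split => //; rewrite -ab.
- by congr (_%:E); apply: eq_bigr => i _; rewrite /kernel_star tAy.
Qed.

(* On [cell u] seen from a point of [cell 0], enorm is at least
   delta (mnorm u - 1), which is where the index shift in [wt] comes from. *)
Lemma weighted_kernel_ge n w y : cell 0 y ->
  \sum_(u <- box n) (Num.sqrt (wt u) / 4)%:E * mvar (K w y) (cell u) <=
  \int[tv (kernel_star K w y)]_x (Num.sqrt (enorm x ^+ d * rho (enorm x) + 1))%:E.
Proof.
move=> y0; set J := \int[_]_x _.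
pose F (u : 'rV[int]_d) : set X := (fun x => x + y)%R @^-1` cell u.
have mF u : measurable (F u).
  by rewrite -[F u]setTI; apply: measurable_shift => //; exact: measurable_cell.
have mphi : measurable_fun setT (fun x : X => x - y)%R by exact: measurable_shift.
(* The variation of the kernel recentred at [y], as a genuine measure at most 4 times
   [tv (kernel_star K w y)]. *)
pose m := pushforward (mvar (K w y)) (fun x : X => x - y)%R.
have mE u : m (F u) = mvar (K w y) (cell u).
  rewrite /m /pushforward; congr (mvar _ _); apply/seteqP.
  by split => x; rewrite /F /preimage /= subrK.
have e0 (x : X) : (0 <= enorm x)%R by exact: sqrtr_ge0.
have : \sum_(u <- box n) (Num.sqrt (wt u))%:E * mvar (K w y) (cell u) <= 4%:E * J.
  rewrite (_ : \sum_(u <- box n) _ = \int[m]_x (\sum_(u <- box n) Num.sqrt (wt u) * \1_(F u) x)%:E).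
    apply: le_integral_setfun => //.
    - by rewrite /m /pushforward preimage_set0 measure0.
    - by rewrite tv_kernel_star translateE preimage_set0 tv0.
    - by move=> A mA; exact: tv_ge0.
    - move=> A mA; rewrite tv_kernel_star /m /pushforward /= -(translateE A).
      exact: mvar_le_tv.
    - by move=> x; rewrite lee_fin sumr_ge0.
    move=> x; rewrite lee_fin; apply: sum_disjoint_indic.
    - exact: box_uniq.
    - by move=> u v _ _ <- <-.
    - exact: sqrtr_ge0.
    move=> u _ Fu; rewrite ler_wsqrtr// lerD2r.
    have h := cell_dist y0 Fu; have [_ hle _] := hrho.
    by rewrite ler_pM ?exprn_ge0 ?rho_ge0// ?lerXn2r ?nnegrE// hle.
  under eq_integral do rewrite -sumEFin.
  rewrite ge0_integral_sum//;
    last by move=> u; apply/measurable_EFinP; apply: measurable_funM.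
  apply: eq_bigr => u _; under eq_integral do rewrite EFinM.
  rewrite ge0_integralZl_EFin ?sqrtr_ge0//; last first.
    by apply/measurable_EFinP; exact: measurable_indic.
  by rewrite integral_indic// setIT -mE.
have J0 : 0 <= J.
  apply: integral_lower_ge0; first by rewrite tv_kernel_star translateE preimage_set0 tv0.
  by move=> x; rewrite lee_fin sqrtr_ge0.
move=> h; have := lee_wpmul2l (_ : 0 <= (4^-1)%:E) h.
rewrite lee_fin invr_ge0 ler0n => /(_ isT).
rewrite muleA -EFinM mulVf ?mul1e ?pnatr_eq0// ge0_sume_distrr; last first.
  by move=> u _; rewrite mule_ge0// lee_fin sqrtr_ge0.
apply: le_trans; rewrite le_eqVlt; apply/orP; left; apply/eqP; apply: eq_bigr => u _.
by rewrite muleA -EFinM mulrC.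
Qed.

Lemma weighted_measure_ge0 w B : 0 <= weighted_measure rho K Phi w B.
Proof.
rewrite /weighted_measure integral_mkcond_setfun; apply: integral_lower_ge0; first exact: tv0.
move=> x; apply: erestrict_ge0 => y _; apply: integral_lower_ge0.
  by rewrite tv_kernel_star translateE preimage_set0 tv0.
by move=> z; rewrite lee_fin sqrtr_ge0.
Qed.

(** Passing from [tv] to [mvar] costs a factor 4 for the kernel and another 4 for Phi, whence 16. *)
Lemma weighted_measure_ge n w :
  \sum_(u <- box n) (Num.sqrt (wt u) / 16)%:E * mass Phi K w (cell 0) (cell u) <=
  weighted_measure rho K Phi w (eball 1).
Proof.
set W := weighted_measure _ _ _ _ _.
have mc := @measurable_cell R d.
have J0 y : 0 <= \int[tv (kernel_star K w y)]_x (Num.sqrt (enorm x ^+ d * rho (enorm x) + 1))%:E.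
  apply: integral_lower_ge0; first by rewrite tv_kernel_star translateE preimage_set0 tv0.
  by move=> x; rewrite lee_fin sqrtr_ge0.
have : \sum_(u <- box n) (Num.sqrt (wt u) / 4)%:E * mass Phi K w (cell 0) (cell u) <= 4%:E * W.
  have mv u : measurable_fun (cell 0) (fun x => mvar (K w x) (cell u)).
    by apply: measurable_funS (measurable_mvarK_at hK w (mc u)).
  have s0 u : (0 <= Num.sqrt (wt u) / 4)%R by rewrite divr_ge0 ?sqrtr_ge0.
  rewrite (eq_bigr (fun u => \int[mvar (Phi w)]_(x in cell 0)
      ((Num.sqrt (wt u) / 4)%:E * mvar (K w x) (cell u)))); last first.
    by move=> u _; rewrite ge0_integralZl_EFin.
  rewrite -ge0_integral_sum//;
    last by move=> u; first [exact: measurable_funeM|move=> x _; rewrite mule_ge0].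
  rewrite /W /weighted_measure integral_mkcond_setfun [X in _ * X]integral_mkcond_setfun.
  apply: le_integral_setfun => //.
  - exact: tv0.
  - by move=> A _; exact: tv_ge0.
  - by move=> A _; exact: mvar_le_tv.
  - move=> x; apply: erestrict_ge0 => y _; apply: sume_ge0 => u _.
    by rewrite mule_ge0.
  move=> x; rewrite !patchE; case: ifPn => [|_].
    rewrite inE => x0; rewrite mem_set; last exact: cell0_eball.
    exact: weighted_kernel_ge.
  by case: ifPn.
have W0 : 0 <= W by exact: weighted_measure_ge0.
move=> h; have := lee_wpmul2l (_ : 0 <= (4^-1)%:E) h.
rewrite lee_fin invr_ge0 ler0n => /(_ isT).
rewrite muleA -EFinM mulVf ?mul1e ?pnatr_eq0// ge0_sume_distrr; last first.
  by move=> u _; rewrite mule_ge0 ?mass_ge0// lee_fin divr_ge0// sqrtr_ge0.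
apply: le_trans; rewrite le_eqVlt; apply/orP; left; apply/eqP; apply: eq_bigr => u _.
rewrite muleA -EFinM; congr (_%:E * _); by field.
Qed.

Lemma mass_sq_log_dominating : exists c : R, forall n,
  \int[P]_w (mass Phi K w (big_box n) (cell 0) ^+ 2) <= c%:E.
Proof.
have mc := @measurable_cell R d.
have [A hA] := log_dominating_box hrho hd.
have A0 : (0 <= A)%R.
  apply: le_trans _ (hA 0%N); apply: sumr_ge0 => z _.
  by rewrite invr_ge0; exact: ltW (wt_gt0 z).
set V := \int[P]_w ((weighted_measure rho K Phi w (eball 1)) ^+ 2).
have V0 : 0 <= V.
  by apply: integral_ge0 => w _; rewrite expe_ge0// weighted_measure_ge0.
(* [A] bounds the sum of the inverse weights, and 256 is the square of 16. *)
exists (A * (256 * fine V))%R => n.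
have m2 u v : measurable_fun setT (fun w => mass Phi K w (cell u) (cell v) ^+ 2).
  under eq_fun do rewrite expe2.
  by apply: emeasurable_funM; apply: (measurable_mass hPhi hK) => //; exact: bounded_cell.
have sq0 w u v : 0 <= mass Phi K w (cell u) (cell v) ^+ 2 by rewrite expe_ge0// mass_ge0.
have wt0 u : (0 <= wt u)%R by exact: ltW.
have wsq0 z w u v : 0 <= (wt z)%:E * mass Phi K w (cell u) (cell v) ^+ 2.
  by apply: mule_ge0; [rewrite lee_fin|exact: sq0].
apply: (@le_trans _ _ (\int[P]_w (A%:E * \sum_(z <- box n) (wt z)%:E *
    mass Phi K w (cell z) (cell 0) ^+ 2))).
  apply: le_integral_lower => // w; first by rewrite expe_ge0// mass_ge0.
  rewrite (mass_box Phi hK)//; apply: le_trans (weighted_cauchy _ wt_gt0 _) _.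
    by move=> z; exact: mass_ge0.
  rewrite lee_wpmul2r ?lee_fin//.
    by apply: sume_ge0 => z _; exact: wsq0.
rewrite ge0_integralZl_EFin//; last 2 first.
- by move=> w _; apply: sume_ge0 => z _; exact: wsq0.
- by apply: emeasurable_sum => z; exact: measurable_funeM.
rewrite EFinM lee_wpmul2l ?lee_fin//.
rewrite ge0_integral_sum//; last by move=> z; exact: measurable_funeM.
(* The weighted measure sees the mass leaving cell 0, whereas the goal concerns the mass entering
   it. A shift by [latt (- z)] exchanges the two in mean. *)
have flip z : \int[P]_w ((wt z)%:E * mass Phi K w (cell z) (cell 0) ^+ 2) =
    (256%:E * \int[P]_w ((Num.sqrt (wt (- z)) / 16)%:E * mass Phi K w (cell 0) (cell (- z))) ^+ 2).
  have -> : \int[P]_w ((wt z)%:E * mass Phi K w (cell z) (cell 0) ^+ 2) =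
      \int[P]_w ((wt (- z))%:E * mass Phi K w (cell 0) (cell (- z)) ^+ 2).
    rewrite -[LHS](integral_flow htheta hP (latt (- z))
      (f := fun w => (wt z)%:E * mass Phi K w (cell z) (cell 0) ^+ 2)); last 2 first.
    - exact: measurable_funeM.
    - by move=> w; exact: wsq0.
    apply: eq_integral => w _; rewrite (mass_shift Phi_inv hK K_inv)//.
    by rewrite !cell_translate subrr add0r /wt mnormN.
  rewrite -ge0_integralZl_EFin//; last 2 first.
  - by move=> w _; rewrite expe_ge0// mule_ge0 ?mass_ge0// lee_fin divr_ge0// sqrtr_ge0.
  - under eq_fun do rewrite expe2.
    have ms : measurable_fun setT (fun w => (Num.sqrt (wt (- z)) / 16)%:E *
        mass Phi K w (cell 0) (cell (- z))).
      by apply: measurable_funeM; apply: (measurable_mass hPhi hK) => //; exact: bounded_cell.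
    exact: emeasurable_funM.
  apply: eq_integral => w _; rewrite !expe2 muleACA [RHS]muleA; congr (_ * _).
  rewrite -!EFinM; congr EFin.
  have /sqr_sqrtr := wt0 (- z)%R; rewrite expr2 => e; rewrite -[LHS]e; by field.
rewrite (eq_bigr _ (fun z _ => flip z)).
(* The box is symmetric, so the sign created by the shift disappears after reindexing. *)
rewrite -(big_map -%R xpredT (fun u => 256%:E * \int[P]_w ((Num.sqrt (wt u) / 16)%:E * mass Phi K w (cell 0) (cell u)) ^+ 2)).
rewrite (perm_big _ (box_opp n)) -ge0_sume_distrr; last first.
  by move=> u _; apply: integral_ge0 => w _; rewrite expe_ge0// mule_ge0 ?mass_ge0// lee_fin divr_ge0// sqrtr_ge0.
rewrite EFinM lee_wpmul2l ?lee_fin//.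
have s0 w u : 0 <= (Num.sqrt (wt u) / 16)%:E * mass Phi K w (cell 0) (cell u).
  by rewrite mule_ge0 ?mass_ge0// lee_fin divr_ge0// sqrtr_ge0.
rewrite -ge0_integral_sum//; last 2 first.
- move=> u; under eq_fun do rewrite expe2.
  have ms : measurable_fun setT (fun w => (Num.sqrt (wt u) / 16)%:E * mass Phi K w (cell 0) (cell u)).
    by apply: measurable_funeM; apply: (measurable_mass hPhi hK) => //; exact: bounded_cell.
  exact: emeasurable_funM.
- by move=> u w _; rewrite expe_ge0.
rewrite fineK ?ge0_fin_numE//; apply: le_integral_lower => // w.
  by rewrite sume_ge0// => u _; rewrite expe_ge0.
apply: le_trans (sum_sqe_le _ (s0 w)) _; apply: sqe_le; first exact: sume_ge0.
exact: weighted_measure_ge.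
Qed.

End log_dominating_case.

Definition invS {R : realType} (k : nat) : R := k.+1%:R^-1.

Lemma invS_gt0 {R : realType} k : 0 < invS k :> R.
Proof. by rewrite invr_gt0. Qed.

(** The inverse of the sum of inverses is below every [e i]; adding 1 to that sum also covers an
    empty index type. *)
Lemma fin_pos_lower_bound {R : realType} {I : finType} (e : I -> R) :
  (forall i, 0 < e i) -> exists2 m : R, 0 < m & forall i, m <= e i.
Proof.
move=> e0; have s0 : 0 <= \sum_i (e i)^-1.
  by apply: sumr_ge0 => i _; rewrite invr_ge0 ltW.
exists (\sum_i (e i)^-1 + 1)^-1; first by rewrite invr_gt0 ltr_wpDl.
move=> i; rewrite -[leRHS]invrK lef_pV2 ?posrE ?invr_gt0 ?ltr_wpDl//.
rewrite (bigD1 i)//= -addrA lerDl addr_ge0// sumr_ge0// => j _.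
by rewrite invr_ge0 ltW.
Qed.

(** * Evaluation on the Skorokhod space *)

Section skorokhod_evaluation.
Context {R : realType} {d : nat}.
Local Notation X := 'rV[R]_d.
Local Notation E := (fcmeasure R d).
Variables (dist : E -> E -> R) (hdist : metrization dist).
Implicit Types (U : set E) (f : X -> E).

Let distC mu nu : dist mu nu = dist nu mu. Proof. by have [_ h _ _] := hdist. Qed.

Let dist_triangle la mu nu : dist la nu <= dist la mu + dist mu nu.
Proof. by have [_ _ h _] := hdist. Qed.

(* Since a cadlag map is continuous on the open quadrant to the right of x, a
   value f x in the open set U is detected along rational points decreasing to x;
   the shrinking of U makes this detection an equivalence. *)
Definition shrink U (m : nat) : set E :=
  [set y | exists2 e : R, invS m < e & forall z, dist y z < e -> U z].

Lemma metric_open_shrink U m : metric_open dist (shrink U m).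
Proof.
move=> y [e em eU]; exists ((e - invS m) / 2); first by rewrite divr_gt0// subr_gt0.
move=> z yz; exists ((e + invS m) / 2); first lra.
move=> t zt; apply: eU; apply: le_lt_trans (dist_triangle _ z _) _; lra.
Qed.

Lemma shrink_near U m y z : shrink U m y -> dist y z < invS m -> U z.
Proof. by move=> [e em eU] yz; apply: eU; exact: lt_trans em. Qed.

Lemma shrink_exists U y : metric_open dist U -> U y -> exists m, shrink U m y.
Proof.
move=> oU /oU[e e0 eU]; have [m me] : exists m : nat, invS m < e.
  exists (Num.truncn e^-1); rewrite /invS invf_plt ?posrE//.
  exact: truncnS_gt.
by exists m, e.
Qed.

Definition near_right (x : X) (k : nat) : set X :=
  [set t | forall i, x 0 i < t 0 i < x 0 i + invS k].

Lemma cadlag_near f x (a : R) : cadlag dist f -> 0 < a ->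
  exists k, forall t, near_right x k t -> dist (f t) (f x) < a.
Proof.
move=> /(_ x)[/(_ a) h _] a0; have [c c0 hc] := h a0.
have [k kc] : exists k : nat, d%:R * invS k < c.
  exists (Num.truncn (d%:R / c)); rewrite /invS ltr_pdivrMr// mulrC -ltr_pdivrMr//.
  exact: truncnS_gt.
exists k => t tx; apply: hc.
  by move=> i; have /andP[/ltW] := tx i.
have k0 := @invS_gt0 R k.
apply: le_lt_trans kc; apply: enorm_le_coord => [|i]; first exact: ltW.
by have /andP[h1 h2] := tx i; rewrite !mxE ler_norml; lra.
Qed.

Definition rvec (q : 'rV[rat]_d) : X := map_mx ratr q.

Lemma near_right_rat x k l : exists2 q, near_right x k (rvec q) & near_right x l (rvec q).
Proof.
have h i : exists q : rat, x 0 i < ratr q < x 0 i + invS (maxn k l).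
  have [|q] := @rat_in_itvoo R (x 0 i) (x 0 i + invS (maxn k l)); first by rewrite ltrDl invS_gt0.
  by rewrite in_itv /=; exists q.
have [q hq] := choice h.
exists (\row_i q i) => i; rewrite !mxE; have /andP[-> h2] /= := hq i;
  apply: lt_le_trans h2 _; rewrite lerD2l /invS lef_pV2 ?posrE// ler_nat ltnS ?leq_maxl ?leq_maxr//.
Qed.

Lemma cadlag_mem_open f x U : cadlag dist f -> metric_open dist U -> U (f x) ->
  exists m, forall k, exists2 q, near_right x k (rvec q) & shrink U m (f (rvec q)).
Proof.
move=> cf oU Ufx; have [m Um] := shrink_exists oU Ufx.
have [e e0 he] := metric_open_shrink Um; have [l hl] := cadlag_near x cf e0.
exists m => k; have [q qk ql] := near_right_rat x k l; exists q => //.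
by apply: he; rewrite distC; exact: hl.
Qed.

Lemma cadlag_open_mem f x U m : cadlag dist f ->
  (forall k, exists2 t, near_right x k t & shrink U m (f t)) -> U (f x).
Proof.
move=> cf h; have m0 := @invS_gt0 R m.
have [k hk] := cadlag_near x cf m0; have [t tk Ut] := h k.
exact: shrink_near Ut (hk _ tk).
Qed.

(** The point [t] ranges over the whole open box: a time change displaces it slightly, so rational
    points alone would not give an open condition. *)
Definition hit x k U : set (X -> E) :=
  [set f | cadlag dist f /\ exists2 t, near_right x k t & U (f t)].

(* The time change is close to the identity near t0, so its coordinates, being
   increasing bijections, reach t0 at a point still inside the box. *)
Lemma skorokhod_open_hit x k U : metric_open dist U -> skorokhod_open dist (hit x k U).
Proof.
move=> oU; split; first by move=> f [].
move=> f [cf [t0 t0x Uft]]; have [e1 e10 he1] := oU _ Uft.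
(* [e2] is half the least distance from the coordinates of [t0] to the faces of the box. *)
have [e2 e20 he2] : exists2 e : R, 0 < e & forall i, x 0 i < t0 0 i - e /\ t0 0 i + e < x 0 i + invS k.
  have [|m m0 hm] := @fin_pos_lower_bound R 'I_d
      (fun i => Num.min (t0 0 i - x 0 i) (x 0 i + invS k - t0 0 i)).
    by move=> i; have /andP[h1 h2] := t0x i; rewrite lt_min; apply/andP; split; lra.
  exists (m / 2); first by rewrite divr_gt0.
  by move=> i; have := hm i; rewrite le_min => /andP[? ?]; split; lra.
pose e := Num.min e1 e2; have e0 : 0 < e by rewrite lt_min e10.
have ee1 : e <= e1 by rewrite ge_min lexx.
have ee2 : e <= e2 by rewrite ge_min lexx orbT.
(* The radius is large enough for every point within e of [t0] in each coordinate; the factor d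
   compares the Euclidean norm with the coordinates. *)
pose r := d%:R * (enorm t0 + e).
have r0 : 0 <= enorm t0 + e by rewrite addr_ge0 ?sqrtr_ge0// ltW.
exists r, e; split => // g [[la [tla hla]] cg]; split => //.
have near (t : X) : (forall i, `|t 0 i - t0 0 i| <= e) -> enorm t <= r.
  move=> tt; apply: enorm_le_coord => // i.
  have := coord_le_enorm t0 i; have := tt i.
  have := ler_normD (t 0 i - t0 0 i) (t0 0 i); rewrite subrK; lra.
have [t ht] : exists t : X, forall i, la i (t 0 i) = t0 0 i.
  have /choice[u hu] : forall i, exists u, la i u = t0 0 i by move=> i; have [_] := tla i; exact.
  by exists (\row_i u i) => i; rewrite mxE.
have mono i u v : (la i u < la i v) = (u < v).
  by apply: (leW_mono (le_mono _)); have [] := tla i.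
pose tp : X := \row_i (t0 0 i + e); pose tm : X := \row_i (t0 0 i - e).
have tpr : enorm tp <= r.
  by apply: near => i; rewrite mxE addrAC subrr add0r gtr0_norm.
have tmr : enorm tm <= r.
  by apply: near => i; rewrite mxE addrAC subrr add0r normrN gtr0_norm.
have lap i : t0 0 i < la i (t0 0 i + e).
  have [h1 _] := hla _ tpr; have := le_lt_trans (coord_le_enorm _ i) h1.
  rewrite !mxE ltr_norml; lra.
have lam i : la i (t0 0 i - e) < t0 0 i.
  have [h1 _] := hla _ tmr; have := le_lt_trans (coord_le_enorm _ i) h1.
  rewrite !mxE ltr_norml; lra.
have tt0 i : t0 0 i - e < t 0 i < t0 0 i + e.
  by apply/andP; split; rewrite -(mono i) ht; [exact: lam|exact: lap].
have tr : enorm t <= r.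
  by apply: near => i; have /andP[? ?] := tt0 i; rewrite ler_norml; lra.
have [_ h2] := hla _ tr.
exists t.
  by move=> i; have /andP[? ?] := tt0 i; have [? ?] := he2 i; apply/andP; split; lra.
apply: he1; rewrite distC; apply: lt_le_trans ee1.
rewrite (_ : t0 = \row_i la i (t 0 i))//.
by apply/rowP => i; rewrite mxE ht.
Qed.

End skorokhod_evaluation.

Section skorokhod_joint.
Context {R : realType} {d : nat}.
Local Notation X := 'rV[R]_d.
Local Notation E := (fcmeasure R d).
Variables (dist : E -> E -> R) (hdist : metrization dist).
Context {dT : measure_display} {T : measurableType dT}.
Variable K : T -> X -> E.
Hypothesis Kcadlag : forall w, cadlag dist (K w).
Hypothesis mK : forall S, skorokhod_sigma dist S -> measurable (K @^-1` S).

Lemma measurable_eval_open U x : metric_open dist U -> measurable [set w | U (K w x)].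
Proof.
move=> oU.
rewrite (_ : mkset _ = \bigcup_m \bigcap_k K @^-1` hit dist x k (shrink dist U m)).
  apply: bigcupT_measurable => m; apply: bigcapT_measurable => k; apply: mK.
  apply: sub_sigma_algebra; apply: (skorokhod_open_hit hdist).
  exact: (metric_open_shrink hdist).
apply/seteqP; split => w /=.
  move=> /(cadlag_mem_open hdist (Kcadlag w) oU)[m hm]; exists m => // k _.
  by split => //; have [q ? ?] := hm k; exists (rvec q).
move=> [m _ h]; apply: (@cadlag_open_mem _ _ dist (K w) x U m (Kcadlag w)) => k.
by have [] := h k I.
Qed.

(** For a fixed rational point [q] the condition on w and the condition on x separate, so the set is
    a countable combination of rectangles. T carries any sigma-algebra making [K] measurable, in
    particular the one generated by [K]. *)
Lemma measurable_joint_open U : metric_open dist U ->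
  measurable [set p : T * X | U (K p.1 p.2)].
Proof.
move=> oU.
rewrite (_ : mkset _ = \bigcup_m \bigcap_k \bigcup_(q : 'rV[rat]_d)
    ([set w | shrink dist U m (K w (rvec q))] `*` [set x | near_right x k (rvec q)])).
  apply: bigcupT_measurable => m; apply: bigcapT_measurable => k.
  apply: countable_bigcupT_measurable => // q; apply: measurableX.
    by apply: measurable_eval_open; exact: (metric_open_shrink hdist).
  have := @measurable_coordset R d
    (fun i => `](ratr (q 0 i) - invS k), (ratr (q 0 i))[%classic) (fun=> measurable_itv _).
  congr measurable; apply/seteqP; split => x /= h i; have := h i;
    rewrite /= ?in_itv /= ?mxE => /andP[? ?]; apply/andP; split; lra.
apply/seteqP; split => -[w x] /=.
  move=> /(cadlag_mem_open hdist (Kcadlag w) oU)[m hm]; exists m => // k _.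
  by have [q ? ?] := hm k; exists q.
move=> [m _ h]; apply: (@cadlag_open_mem _ _ dist (K w) x U m (Kcadlag w)) => k.
by have [q _ [? ?]] := h k I; exists (rvec q).
Qed.

Lemma measurable_joint S : eval_sigma R d S -> measurable [set p : T * X | S (K p.1 p.2)].
Proof.
have [_ _ _ h] := hdist => /h.
suff : <<s metric_open dist>> `<=` [set V | measurable [set p : T * X | V (K p.1 p.2)]].
  by move=> sub /sub.
apply: smallest_sub; last by move=> U; exact: measurable_joint_open.
split => /=.
- by rewrite (_ : mkset _ = set0)//; apply/seteqP; split.
- move=> V mV; rewrite (_ : mkset _ = ~` [set p : T * X | V (K p.1 p.2)]).
    exact: measurableC.
  by apply/seteqP; split => p //= [].
- move=> V mV; rewrite (_ : mkset _ = \bigcup_n [set p : T * X | V n (K p.1 p.2)]).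
    exact: bigcupT_measurable.
  by apply/seteqP; split.
Qed.

End skorokhod_joint.

(** * Independence and ordered double sums *)

Section independence.
Local Open Scope ereal_scope.
Context {R : realType} {d0 d1 d2 : measure_display} {T : measurableType d0}
  {T1 : measurableType d1} {T2 : measurableType d2}.
Variables (P : probability T R) (X1 : {mfun T >-> T1}) (X2 : {mfun T >-> T2}).

(** The joint law agrees with the product law on rectangles, hence everywhere, and Tonelli
    applies. *)
Lemma independent_integral (F : T1 * T2 -> \bar R) :
  (forall A B, measurable A -> measurable B ->
    P (X1 @^-1` A `&` X2 @^-1` B) = P (X1 @^-1` A) * P (X2 @^-1` B)) ->
  (forall p, 0 <= F p) -> measurable_fun setT F ->
  \int[P]_w F (X1 w, X2 w) = \int[P]_w2 \int[P]_w1 F (X1 w1, X2 w2).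
Proof.
move=> ind F0 mF.
have mX : measurable_fun setT (fun w => (X1 w, X2 w)) by exact: measurable_fun_pair.
rewrite -[LHS](@ge0_integral_pushforward _ _ _ _ _ _ mX P setT F)//.
rewrite (eq_measure_integral (distribution P X1 \x distribution P X2)); last first.
  move=> A mA _; apply/esym; exact: product_measure_unique.
rewrite fubini_tonelli2// ge0_integral_distribution//; last 2 first.
- exact: measurable_fun_fubini_tonelli_G.
- by move=> y; apply: integral_ge0.
apply: eq_integral => w2 _ /=; rewrite /fubini_G ge0_integral_distribution//.
exact: measurableT_comp mF (pair2_measurable _).
Qed.

End independence.

Section product_bounds.
Local Open Scope ereal_scope.
Context {R : realType}.

Lemma mule_le_sqD (x y : \bar R) : 0 <= x -> 0 <= y -> x * y <= x ^+ 2 + y ^+ 2.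
Proof.
move=> x0 y0; rewrite !expe2; have [xy|/ltW yx] := leP x y.
  by apply: lee_paddl; [rewrite mule_ge0|rewrite lee_wpmul2r].
by apply: lee_paddr; [rewrite mule_ge0|rewrite lee_wpmul2l].
Qed.

(** Each pair satisfies at least one of the two orderings; by symmetry both halves are the same sum,
    with ties counted twice. *)
Lemma sq_sum_le_ordered (I : Type) (s : seq I) (ord : I -> nat) (x : I -> \bar R) :
  (forall i, 0 <= x i) ->
  (\sum_(i <- s) x i) ^+ 2 <=
  2%:E * \sum_(i <- s) x i * \sum_(j <- s | (ord j <= ord i)%N) x j.
Proof.
move=> x0; have S0 (p : pred I) : 0 <= \sum_(j <- s | p j) x j by exact: sume_ge0.
have e : (\sum_(i <- s) x i) ^+ 2 = \sum_(i <- s) \sum_(j <- s) x i * x j.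
  rewrite expe2 ge0_sume_distrl//; apply: eq_bigr => i _.
  by rewrite ge0_sume_distrr.
have le1 i : \sum_(j <- s) x i * x j <=
    \sum_(j <- s | (ord j <= ord i)%N) x i * x j + \sum_(j <- s | (ord i <= ord j)%N) x i * x j.
  rewrite (bigID (fun j => ord j <= ord i)%N)/= leeD2l//.
  rewrite big_mkcond [leRHS]big_mkcond; apply: lee_sum => j _.
  by case: leqP => /= [_|/ltnW ->//]; case: ifP => // _; rewrite mule_ge0.
rewrite e; apply: le_trans (lee_sum _ (fun i _ => le1 i)) _.
rewrite big_split/= [X in _ + X](exchange_big_dep xpredT)//=.
rewrite (_ : 2%:E * _ = \sum_(i <- s) x i * \sum_(j <- s | (ord j <= ord i)%N) x j +
   \sum_(i <- s) x i * \sum_(j <- s | (ord j <= ord i)%N) x j); last first.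
  set Q := \sum_(i <- s) _; have Q0 : 0 <= Q by apply: sume_ge0 => i _; exact: mule_ge0.
  case: Q Q0 => [r _| |//]; first by rewrite -EFinM -EFinD; congr (_%:E); ring.
  by rewrite gt0_muley ?lte_fin.
apply: leeD; apply: lee_sum => i _; rewrite ge0_sume_distrr//.
by apply: lee_sum => j _; rewrite muleC.
Qed.

End product_bounds.

(** * Counting cells near a displacement *)

Section enorm_measurable.
Context {R : realType} {d : nat}.
Local Notation X := 'rV[R]_d.

Lemma measurable_enorm : measurable_fun setT (@enorm R d).
Proof.
have ms : measurable_fun setT (fun x : X => \sum_i x 0 i ^+ 2).
  by apply: measurable_sum => i; apply: measurable_funX; exact: measurable_coord.
apply: measurableT_comp ms; apply: continuous_measurable_fun.
exact: sqrt_continuous.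
Qed.

(** At most 2^d terms are nonzero, and each of them has [mnorm z] at most |x| / delta + 1. *)
Lemma near_cell_sum_le : exists C : R, 0 <= C /\ forall n (x : X),
  \sum_(z <- box n) ((mnorm z).*2.+1 ^ d)%:R * \1_(near_cell z) x <= C * (1 + enorm x ^+ d).
Proof.
have dg := @delta_gt0 R d; have d0 : 0 <= 2 / @delta R d by rewrite divr_ge0// ltW.
(* Chosen so that 2 [mnorm z] + 1 <= 2 r / delta + 3 <= c (1 + r). The further 2^d comes from (1 +
   r)^d <= 2^d (1 + r^d). *)
have [c [c0 c3 c3']] : exists c : R, [/\ 0 <= c, 2 / @delta R d <= c & 3 <= c].
  by exists (2 / @delta R d + 3); split; lra.
exists ((2 ^ d)%:R * (c ^+ d * 2 ^+ d)); split; first by rewrite !mulr_ge0 ?exprn_ge0.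
move=> n x; set r := enorm x; have r0 : 0 <= r by exact: sqrtr_ge0.
apply: (@le_trans _ _ (\sum_(z <- box n) (c * (1 + r)) ^+ d * \1_(near_cell z) x)).
  apply: ler_sum => z _; rewrite indicE; case: (boolP (x \in near_cell z)); last by rewrite !mulr0.
  rewrite inE => /near_cell_mnorm h; rewrite !mulr1 natrX lerXn2r ?nnegrE ?mulr_ge0 ?addr_ge0//.
  have {}h : (mnorm z)%:R <= r / @delta R d + 1.
    have -> : r / @delta R d + 1 = (r + @delta R d) / @delta R d by rewrite mulrDl divff ?gt_eqF.
    by rewrite ler_pdivlMr// mulrC.
  rewrite -natr1 -muln2 natrM.
  have : r * (2 / @delta R d) <= r * c by rewrite ler_wpM2l.
  have -> : r * (2 / @delta R d) = 2 * (r / @delta R d) by ring.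
  lra.
rewrite -mulr_sumr.
have cnt : \sum_(z <- box n) (\1_(near_cell z) x : R) <= (2 ^ d)%:R.
  apply: (@le_trans _ _ (count (fun z => `[< near_cell z x >]) (box n))%:R); last first.
    by rewrite ler_nat count_near_cell.
  rewrite -sum1_count natr_sum [leRHS]big_mkcond; apply: ler_sum => z _.
  rewrite indicE; case: ifPn => /asboolP h; first by rewrite mem_set.
  by rewrite memNset.
rewrite mulrC -mulrA; apply: ler_pM => //.
- by apply: sumr_ge0 => z _; rewrite indicE.
- by rewrite exprn_ge0// mulr_ge0// addr_ge0.
rewrite exprMn -mulrA ler_wpM2l ?exprn_ge0//.
have [r1|/ltW r1] := leP r 1.
  apply: (@le_trans _ _ (2 ^+ d)); first by rewrite lerXn2r ?nnegrE ?addr_ge0//; lra.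
  by rewrite ler_peMr ?exprn_ge0// lerDl exprn_ge0.
apply: (@le_trans _ _ ((2 * r) ^+ d)).
  by rewrite lerXn2r ?nnegrE ?addr_ge0 ?mulr_ge0//; lra.
by rewrite exprMn ler_wpM2l ?exprn_ge0// lerDr.
Qed.

End enorm_measurable.

(** The base set [D] is kept general because the Skorokhod sigma-algebra lives on the cadlag maps,
    not on all maps. *)
Lemma sigma_algebra_preimage_of {T Y : Type} (f : T -> Y) (D : set Y) (G : set (set Y)) :
  sigma_algebra D G -> (forall w, D (f w)) -> sigma_algebra setT [set f @^-1` S | S in G].
Proof.
move=> [G0 GC GU] Df; split.
- by exists set0 => //; rewrite preimage_set0.
- move=> _ [S GS <-]; exists (D `\` S); first exact: GC.
  by apply/seteqP; split => w //= [].
- move=> F FG; have /choice[S hS] : forall n, exists S, G S /\ f @^-1` S = F n.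
    by move=> n; have [S ? ?] := FG n; exists S.
  exists (\bigcup_n S n); first by apply: GU => n; have [] := hS n.
  by rewrite preimage_bigcup; apply: eq_bigcupr => n _; have [] := hS n.
Qed.

Section integral_helpers.
Local Open Scope ereal_scope.
Context {dT : measure_display} {T : measurableType dT} {R : realType}.

(** The constant is divided out of the measurable function [f], since [g] will involve [tv], out of
    whose integral a factor cannot be pulled directly. *)
Lemma le_integral_scale (m : {measure set T -> \bar R}) (c : R) (f g : T -> \bar R) :
  (0 < c)%R -> measurable_fun setT f -> (forall x, 0 <= f x) ->
  (forall x, f x <= c%:E * g x) -> \int[m]_x f x <= c%:E * \int[m]_x g x.
Proof.
move=> c0 mf f0 fg.
have e x : f x = c%:E * ((c^-1)%:E * f x) by rewrite muleA -EFinM mulfV ?mul1e// gt_eqF.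
have ci0 : 0 <= (c^-1)%:E by rewrite lee_fin invr_ge0 ltW.
have cf0 x : 0 <= (c^-1)%:E * f x by rewrite mule_ge0.
under eq_integral do rewrite e.
rewrite ge0_integralZl_EFin//; [|exact: measurable_funeM|exact: ltW].
apply: lee_wpmul2l; first by rewrite lee_fin ltW.
apply: le_integral_lower => // x.
have := lee_wpmul2l ci0 (fg x).
by rewrite muleA -EFinM mulVf ?mul1e// gt_eqF.
Qed.

Lemma independent_integral_fun {d1 d2} {T1 : measurableType d1} {T2 : measurableType d2}
    (P : probability T R) (X1 : T -> T1) (X2 : T -> T2) (F : T1 * T2 -> \bar R) :
  measurable_fun setT X1 -> measurable_fun setT X2 ->
  (forall A B, measurable A -> measurable B ->
    P (X1 @^-1` A `&` X2 @^-1` B) = P (X1 @^-1` A) * P (X2 @^-1` B)) ->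
  (forall p, 0 <= F p) -> measurable_fun setT F ->
  \int[P]_w F (X1 w, X2 w) = \int[P]_w2 \int[P]_w1 F (X1 w1, X2 w2).
Proof.
move=> m1 m2 ind F0 mF.
pose Y1 : {mfun T >-> T1} := HB.pack X1 (isMeasurableFun.Build _ _ _ _ X1 m1).
pose Y2 : {mfun T >-> T2} := HB.pack X2 (isMeasurableFun.Build _ _ _ _ X2 m2).
exact: (@independent_integral _ _ _ _ _ _ _ P Y1 Y2 F).
Qed.

End integral_helpers.

Lemma sum_const_le {R : realType} {I : Type} (s : seq I) (p : pred I) (x : \bar R) N :
  (0 <= x)%E -> (count p s <= N)%N -> (\sum_(i <- s | p i) x <= N%:R%:E * x)%E.
Proof.
move=> x0 cN; apply: (@le_trans _ _ ((count p s)%:R%:E * x)%E).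
  elim: s {cN} => [|i s ih]; first by rewrite big_nil mul0e.
  rewrite big_cons /=; case: (p i) => //=.
  by rewrite natrD EFinD ge0_muleDl ?lee_fin// mul1e leeD.
by rewrite lee_wpmul2r// lee_fin ler_nat.
Qed.

(** * The independent case *)

Section independent_case.
Local Open Scope ereal_scope.
Context {R : realType} {d : nat} {dT : measure_display} {T : measurableType dT}.
Local Notation X := 'rV[R]_d.
Variable P : probability T R.
Variables (theta : X -> T -> T) (htheta : measurable_flow theta) (hP : preserves P theta).
Variables (Phi : T -> cmeasure R d) (K : T -> X -> fcmeasure R d).
Hypotheses (hPhi : random_cmeasure Phi) (Phi_inv : cmeasure_invariant theta Phi).
Hypotheses (hK : transport_kernel K) (K_inv : kernel_invariant theta K).
Hypothesis Phi_sq : loc_abs_sq_integrable P Phi.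
Hypothesis hb : uniformly_bounded_tv K.
Hypothesis hind : independent_kernel P K Phi.
Hypothesis hm : \int[P]_w \int[tv (K w 0%R)]_x (enorm x ^+ d)%:E < +oo.

Let mc := @measurable_cell R d.

Lemma cell_sq_bound : exists s : R, (0 <= s)%R /\
  forall z, \int[P]_w (mvar (Phi w) (cell z) ^+ 2) <= s%:E.
Proof.
set Q := \int[P]_w (tv (Phi w) (eball 1) ^+ 2).
have Q0 : 0 <= Q by apply: integral_ge0 => w _; rewrite expe_ge0// tv_ge0.
have Qfin : Q \is a fin_num by rewrite ge0_fin_numE.
have m2 z : measurable_fun setT (fun w => mvar (Phi w) (cell z) ^+ 2).
  by under eq_fun do rewrite expe2; apply: emeasurable_funM; exact: (measurable_mvarPhi hPhi).
(* The constant 4 between [mvar] and [tv], squared. *)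
exists (16 * fine Q)%R; split; first by rewrite mulr_ge0// fine_ge0.
move=> z; have -> : \int[P]_w (mvar (Phi w) (cell z) ^+ 2) = \int[P]_w (mvar (Phi w) (cell 0) ^+ 2).
  rewrite -[RHS](integral_flow htheta hP (latt z) (f := fun w => mvar (Phi w) (cell 0) ^+ 2))//; last first.
    by move=> w; rewrite expe_ge0.
  apply: eq_integral => w _.
  have -> : mvar (Phi (theta (latt z) w)) (cell 0) = mvar (Phi w) (translate (cell 0) (latt z)).
    by apply: mvar_translate => A bA; exact: Phi_inv.
  by rewrite cell_translate add0r.
rewrite EFinM fineK//; apply: le_integral_scale => // w; first by rewrite expe_ge0.
rewrite (_ : 16%:E * _ = (4%:E * tv (Phi w) (eball 1)) ^+ 2); last first.
  by rewrite !expe2 muleACA -EFinM; congr (_%:E * _); ring.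
apply: sqe_le => //; apply: le_trans (mvar_le_tv _ _) _.
by rewrite lee_wpmul2l ?lee_fin//; exact: le_tv (@cell0_eball R d).
Qed.

Lemma kernel_bound : exists b : R, (0 <= b)%R /\ forall w x, mvar (K w x) setT <= b%:E.
Proof.
have [b hb'] := hb; exists (4 * `|b|)%R; split; first by rewrite mulr_ge0.
move=> w x; apply: le_trans (mvar_le_tv _ _) _; rewrite EFinM lee_wpmul2l ?lee_fin//.
by apply: le_trans (hb' w x) _; rewrite lee_fin ler_norm.
Qed.

Let a (z : 'rV[int]_d) : \bar R := \int[P]_w mvar (K w 0%R) (near_cell z).

Let a_ge0 z : 0 <= a z. Proof. exact: integral_ge0. Qed.

Lemma measurable_mvarK_pt x B : measurable B -> measurable_fun setT (fun w => mvar (K w x) B).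
Proof.
by move=> mB; apply: (measurableT_comp (measurable_mvarK hK mB) (pair2_measurable x)).
Qed.

(** Shifting by [x] itself turns K_x into K_0, and the displacements from [x] into cell 0 all lie in
    [near_cell z]. *)
Lemma mean_kernel_le x z : cell z x -> \int[P]_w mvar (K w x) (cell 0) <= a z.
Proof.
move=> xz; have mn := @measurable_near_cell R d z.
rewrite /a -(integral_flow htheta hP x (f := fun w => mvar (K w 0%R) (near_cell z)))//; last first.
  exact: measurable_mvarK_pt.
apply: le_integral_lower => // w.
have -> : mvar (K (theta x w) 0%R) (near_cell z) = mvar (K w x) (translate (near_cell z) x).
  by apply: mvar_translate => A bA; rewrite K_inv// add0r.
apply: le_mvar => t t0; exists (t - x)%R; last by rewrite subrK.
by apply: near_cellP xz _; rewrite subrK.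
Qed.

(** With Phi frozen at [w2], Tonelli puts the mean over the kernel inside. The restriction to
    [cell z] provides the finite measure that Tonelli requires. *)
Lemma swapped_mean_le w2 z :
  \int[P]_w1 \int[mvar (Phi w2)]_(x in cell z) mvar (K w1 x) (cell 0) <=
  a z * mvar (Phi w2) (cell z).
Proof.
have fin : mvar (Phi w2) (cell z) < +oo by apply: mvar_bounded; exact: bounded_cell.
pose m := mfrestr (mc z) fin.
have mK := measurable_mvarK hK (mc 0).
rewrite (_ : \int[P]_w1 _ = \int[P]_w1 \int[m]_x mvar (K w1 x) (cell 0)); last first.
  apply: eq_integral => w1 _; rewrite -integral_mrestr//.
  exact: measurable_mvarK_at.
rewrite (@fubini_tonelli _ _ _ _ _ P m (fun p => mvar (K p.1 p.2) (cell 0)))//.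
rewrite /m integral_mrestr//; last 2 first.
- by move=> x; exact: integral_ge0.
- exact: (@measurable_fun_fubini_tonelli_G _ _ _ _ _ P (fun p => mvar (K p.1 p.2) (cell 0))).
rewrite -(integral_cst (mvar (Phi w2)) (mc z) (a z)).
apply: ge0_le_integral.
- exact: mc.
- by move=> x _; exact: integral_ge0.
- apply: measurable_funTS.
  exact: (@measurable_fun_fubini_tonelli_G _ _ _ _ _ P (fun p => mvar (K p.1 p.2) (cell 0))).
- exact: measurable_cst.
- by move=> x xz; exact: mean_kernel_le.
Qed.

(* K and Phi do not take values in measurable types here; independence is used by
   giving T the sigma-algebras generated by K and by Phi, and taking the identity
   as the random element. *)
Lemma decouple s z v : (forall z, \int[P]_w (mvar (Phi w) (cell z) ^+ 2) <= s%:E) ->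
  \int[P]_w (mass Phi K w (cell z) (cell 0) * mvar (Phi w) (cell v)) <= a z * (s + s)%:E.
Proof.
move=> hs; have [dist [hdist [Kc mK] ind]] := hind.
pose GK : set (set T) := [set K @^-1` S | S in skorokhod_sigma dist].
pose GP : set (set T) := [set Phi @^-1` S | S in eval_sigma R d].
have sK : sigma_algebra setT GK.
  apply: sigma_algebra_preimage_of Kc; exact: smallest_sigma_algebra.
have sP : sigma_algebra setT GP.
  apply: (@sigma_algebra_preimage_of _ _ Phi setT) => //; exact: smallest_sigma_algebra.
pose T1 := g_sigma_algebraType GK; pose T2 := g_sigma_algebraType GP.
(* [GK] is already a sigma-algebra, so every measurable set of [T1] is literally a preimage under
   [K]. *)
have T1E A : measurable (A : set T1) -> GK A.
  by rewrite /measurable /= sigma_algebra_id.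
have T2E A : measurable (A : set T2) -> GP A.
  by rewrite /measurable /= sigma_algebra_id.
have mM2 B : measurable B -> measurable_fun setT (fun w : T2 => mvar (Phi w) B).
  move=> mB; apply: (measurable_mvar (Phi := Phi : T2 -> cmeasure R d)) => // S hS.
  by apply: sub_sigma_algebra; exists S.
(* The hypothesis [hK] refers to the full sigma-algebra of T; for the one generated by [K], joint
   measurability comes from cadlag paths. *)
have mK1 : measurable_fun setT (fun p : T1 * X => mvar (K p.1 p.2) (cell 0)).
  apply: (measurable_mvar (Phi := fun p : T1 * X => K p.1 p.2 : cmeasure R d)) => // S.
  apply: (measurable_joint hdist (K := K : T1 -> _)) => // S' hS'.
  by apply: sub_sigma_algebra; exists S'.
pose I (p : T1 * T2) := \int[mvar (Phi p.2)]_(x in cell z) mvar (K p.1 x) (cell 0).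
have I0 p : 0 <= I p by exact: integral_ge0.
have mI : measurable_fun setT I.
  apply: (@measurable_kernel_integral _ _ _ _ _ (fun p : T1 * T2 => mvar (Phi p.2)) _
     (cell z) (fun q => mvar (K q.1.1 q.2) (cell 0))) => //.
  - by move=> B mB; exact: measurableT_comp (mM2 _ mB) _.
  - by move=> p; apply: mvar_bounded; exact: bounded_cell.
  - have mq : measurable_fun setT (fun q : (T1 * T2) * X => (q.1.1, q.2) : T1 * X).
      apply: measurable_fun_pair => //.
      exact: measurableT_comp measurable_fst measurable_fst.
    exact: measurableT_comp mK1 mq.
have mF : measurable_fun setT (fun p => I p * mvar (Phi p.2) (cell v)).
  apply: emeasurable_funM => //.
  exact: measurableT_comp (mM2 _ (mc v)) measurable_snd.
have := @independent_integral_fun _ _ R _ _ T1 T2 P idfun idfun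
  (fun p => I p * mvar (Phi p.2) (cell v)).
rewrite /= => ->//; first last.
- by move=> p; rewrite mule_ge0.
- by move=> A B /T1E[S hS <-] /T2E[S' hS' <-]; exact: ind.
- by move=> _ A /T2E[S hS <-]; rewrite setTI; exact: hPhi.
- by move=> _ A /T1E[S hS <-]; rewrite setTI; exact: mK.
have mv u : measurable_fun setT (fun w => mvar (Phi w) (cell u)).
  exact: (measurable_mvarPhi hPhi).
(* The mean over [w1] yields [a z] times the variation of [Phi w2] on [cell z]. The two remaining
   cell variations belong to the same [Phi w2] and are decoupled by x y <= x^2 + y^2. *)
apply: (@le_trans _ _ (\int[P]_w2 (a z * (mvar (Phi w2) (cell z) ^+ 2 + mvar (Phi w2) (cell v) ^+ 2)))).
  apply: le_integral_lower => //.
    by move=> w2; apply: integral_ge0 => w1 _; rewrite mule_ge0.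
  move=> w2; rewrite ge0_integralZr//; last first.
    apply: (@measurable_kernel_integral _ _ _ _ _ (fun _ : T => mvar (Phi w2)) _
     (cell z) (fun q => mvar (K q.1 q.2) (cell 0))) => //.
    - by move=> _; apply: mvar_bounded; exact: bounded_cell.
    - exact: (measurable_mvarK hK).
  apply: le_trans (lee_wpmul2r _ (swapped_mean_le w2 z)) _ => //.
  by rewrite -muleA lee_wpmul2l//; exact: mule_le_sqD.
have m2 u : measurable_fun setT (fun w => mvar (Phi w) (cell u) ^+ 2).
  by under eq_fun do rewrite expe2; exact: emeasurable_funM.
have p2 u w : 0 <= mvar (Phi w) (cell u) ^+ 2 by rewrite expe_ge0.
rewrite ge0_integralZl//; last 2 first.
- exact: emeasurable_funD.
- by move=> w _; rewrite adde_ge0.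
rewrite lee_wpmul2l// ge0_integralD// EFinD leeD//; exact: hs.
Qed.

(** Exchanging the sum with the integrals leaves C (1 + |x|^d) integrated against K_0: the constant
    part is bounded by the total mass, the rest by the assumed moment. *)
Lemma sum_mean_kernel : exists c : R, (0 <= c)%R /\
  forall n, \sum_(z <- box n) ((mnorm z).*2.+1 ^ d)%:R%:E * a z <= c%:E.
Proof.
have [b [b0 hb']] := kernel_bound; have [C [C0 hC]] := @near_cell_sum_le R d.
pose J w := \int[mvar (K w 0%R)]_x (enorm x ^+ d)%:E.
have me : measurable_fun setT (fun x : X => (enorm x ^+ d)%:E).
  by apply/measurable_EFinP; apply: measurable_funX; exact: measurable_enorm.
have e0 (x : X) : 0 <= (enorm x ^+ d)%:E by rewrite lee_fin exprn_ge0// sqrtr_ge0.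
have J0 w : 0 <= J w by exact: integral_ge0.
have mJ : measurable_fun setT J.
  apply: (@measurable_kernel_integral _ _ _ _ _ (fun w => mvar (K w 0%R)) _
     setT (fun p => (enorm p.2 ^+ d)%:E)) => //.
  - by move=> B mB; exact: measurable_mvarK_pt.
  - by move=> w; apply: le_lt_trans (hb' w 0%R) _; rewrite ltry.
  - exact: measurableT_comp me measurable_snd.
have Jfin : \int[P]_w J w < +oo.
  apply: (@le_lt_trans _ _ (4%:E * \int[P]_w \int[tv (K w 0%R)]_x (enorm x ^+ d)%:E)).
    apply: le_integral_scale => // w; apply: le_integral_setfun => //.
    - exact: tv0.
    - by move=> A _; exact: tv_ge0.
    - by move=> A _; exact: mvar_le_tv.
  by rewrite lte_mul_pinfty.
have {}Jfin : \int[P]_w J w \is a fin_num by rewrite ge0_fin_numE//; exact: integral_ge0.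
exists (C * (b + fine (\int[P]_w J w)))%R.
split; first by rewrite mulr_ge0// addr_ge0// fine_ge0// integral_ge0.
move=> n; have mn z := @measurable_near_cell R d z.
have p0 z : 0 <= ((mnorm z).*2.+1 ^ d)%:R%:E :> \bar R by rewrite lee_fin.
rewrite (_ : \sum_(z <- box n) _ = \int[P]_w \sum_(z <- box n)
    (((mnorm z).*2.+1 ^ d)%:R%:E * mvar (K w 0%R) (near_cell z))); last first.
  rewrite ge0_integral_sum//.
  - by apply: eq_bigr => z _; rewrite ge0_integralZl//; exact: measurable_mvarK_pt.
  - by move=> z; apply: measurable_funeM; exact: measurable_mvarK_pt.
have bound w : \sum_(z <- box n) (((mnorm z).*2.+1 ^ d)%:R%:E * mvar (K w 0%R) (near_cell z)) <=
    C%:E * (b%:E + J w).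
  apply: (@le_trans _ _ (\int[mvar (K w 0%R)]_x (C * (1 + enorm x ^+ d))%:E)).
    rewrite (_ : \sum_(z <- box n) _ = \int[mvar (K w 0%R)]_x \sum_(z <- box n)
       (((mnorm z).*2.+1 ^ d)%:R%:E * (\1_(near_cell z) x)%:E)); last first.
      rewrite ge0_integral_sum//.
      - apply: eq_bigr => z _; rewrite ge0_integralZl//.
        + by rewrite integral_indic// setIT.
        + by apply/measurable_EFinP; exact: measurable_indic.
      - by move=> z; apply: measurable_funeM; apply/measurable_EFinP; exact: measurable_indic.
    apply: le_integral_lower => // x.
      by apply: sume_ge0 => z _; rewrite mule_ge0// lee_fin.
    rewrite (_ : \sum_(z <- box n) _ = (\sum_(z <- box n)
       ((mnorm z).*2.+1 ^ d)%:R * \1_(near_cell z) x)%R%:E); first by rewrite lee_fin.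
    by rewrite -sumEFin; apply: eq_bigr => z _; rewrite EFinM.
  under eq_integral do rewrite EFinM EFinD.
  rewrite ge0_integralZl_EFin//; last 2 first.
  - by move=> x _; rewrite adde_ge0// lee_fin.
  - exact: emeasurable_funD.
  apply: lee_wpmul2l; first by rewrite lee_fin.
  by rewrite ge0_integralD// integral_cst// mul1e leeD.
apply: (@le_trans _ _ (\int[P]_w (C%:E * (b%:E + J w)))).
  apply: le_integral_lower => // w.
  by apply: sume_ge0 => z _; rewrite mule_ge0.
rewrite ge0_integralZl_EFin//; last 2 first.
- by move=> w _; rewrite adde_ge0// lee_fin.
- exact: emeasurable_funD.
rewrite ge0_integralD//.
rewrite integral_cst// [X in b%:E * X](_ : _ = 1); last exact: probability_setT.
by rewrite mule1 EFinM EFinD fineK.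
Qed.

Lemma mass_sq_independent : exists c : R, forall n,
  \int[P]_w (mass Phi K w (big_box n) (cell 0) ^+ 2) <= c%:E.
Proof.
have [b [b0 hb']] := kernel_bound; have [s [s0 hs]] := cell_sq_bound.
have [c [c0 hc]] := sum_mean_kernel.
(* The 2 comes from ordering the pairs, [b] from the kernel mass at the smaller index, [s + s] from
   decoupling and [c] from the moment. *)
exists (2 * b * ((s + s) * c))%R => n.
have mv u : measurable_fun setT (fun w => mvar (Phi w) (cell u)).
  exact: (measurable_mvarPhi hPhi).
have mm z : measurable_fun setT (fun w => mass Phi K w (cell z) (cell 0)).
  by apply: (measurable_mass hPhi hK) => //; exact: bounded_cell.
have mass_le w z : mass Phi K w (cell z) (cell 0) <= b%:E * mvar (Phi w) (cell z).
  rewrite -(integral_cst (mvar (Phi w)) (mc z) b%:E).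
  apply: ge0_le_integral.
  - exact: mc.
  - by [].
  - by apply: measurable_funTS; exact: (measurable_mvarK_at hK).
  - exact: measurable_cst.
  - by move=> x _; apply: le_trans (hb' w x); exact: le_mvar.
pose G w := \sum_(z <- box n) \sum_(v <- box n | (mnorm v <= mnorm z)%N)
  mass Phi K w (cell z) (cell 0) * mvar (Phi w) (cell v).
have m0 w z : 0 <= mass Phi K w (cell z) (cell 0) by exact: mass_ge0.
have mp z v : measurable_fun setT (fun w => mass Phi K w (cell z) (cell 0) * mvar (Phi w) (cell v)).
  exact: emeasurable_funM.
have mG z : measurable_fun setT (fun w => \sum_(v <- box n | (mnorm v <= mnorm z)%N)
    mass Phi K w (cell z) (cell 0) * mvar (Phi w) (cell v)).
  under eq_fun do rewrite -big_filter; by apply: emeasurable_sum => v.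
have bound w : mass Phi K w (big_box n) (cell 0) ^+ 2 <= (2 * b)%:E * G w.
  rewrite (mass_box Phi hK)//; apply: le_trans (sq_sum_le_ordered _ mnorm _) _ => //.
  rewrite EFinM -muleA lee_wpmul2l ?lee_fin// ge0_sume_distrr; last first.
    by move=> z _; apply: sume_ge0 => v _; rewrite mule_ge0.
  apply: lee_sum => z _; rewrite -ge0_sume_distrr// muleCA lee_wpmul2l//.
  by rewrite ge0_sume_distrr//; apply: lee_sum => v _; exact: mass_le.
apply: (@le_trans _ _ (\int[P]_w ((2 * b)%:E * G w))).
  by apply: le_integral_lower => // w; rewrite expe_ge0// mass_ge0.
have G0 w z : 0 <= \sum_(v <- box n | (mnorm v <= mnorm z)%N)
    mass Phi K w (cell z) (cell 0) * mvar (Phi w) (cell v).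
  by apply: sume_ge0 => v _; rewrite mule_ge0.
rewrite ge0_integralZl_EFin ?mulr_ge0//; last 2 first.
- by move=> w _; apply: sume_ge0.
- exact: emeasurable_sum.
rewrite [leRHS]EFinM; apply: lee_wpmul2l; first by rewrite lee_fin mulr_ge0.
rewrite ge0_integral_sum//.
apply: (@le_trans _ _ (\sum_(z <- box n) (((mnorm z).*2.+1 ^ d)%:R%:E * a z) * (s + s)%:E)).
  apply: lee_sum => z _.
  under eq_integral do rewrite -big_filter.
  rewrite ge0_integral_sum//; last by move=> v w _; rewrite mule_ge0.
  rewrite big_filter -muleA.
  apply: le_trans (lee_sum _ (fun v _ => decouple z v hs)) _.
  (* The decoupled bound is the same for all v, so the inner sum is at most the number of lattice
     points with [mnorm v <= mnorm z] times it. *)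
  by apply: sum_const_le; [rewrite mule_ge0// lee_fin addr_ge0|exact: count_le_mnorm].
rewrite -ge0_sume_distrl; last by move=> z _; rewrite mule_ge0.
rewrite muleC EFinM lee_wpmul2l ?lee_fin ?addr_ge0//.
Qed.

End independent_case.

(** The first conjunct is the almost sure well-definedness of K Phi: [kernel_apply] is a total
    function, so the second conjunct would not express it. *)
Theorem theorem4p4 (R : realType) (d : nat) (hd : (0 < d)%N)
    (dT : measure_display) (T : measurableType dT) (P : probability T R)
    (theta : 'rV[R]_d -> T -> T)
    (htheta : measurable_flow theta) (hP : preserves P theta)
    (Phi : T -> cmeasure R d) (K : T -> 'rV[R]_d -> fcmeasure R d)
    (hPhi : random_cmeasure Phi) (Phi_inv : cmeasure_invariant theta Phi)
    (Phi_sq : loc_abs_sq_integrable P Phi)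
    (hK : transport_kernel K) (K_inv : kernel_invariant theta K)
    (hab :
      (exists2 rho : R -> R, strongly_log_dominating rho &
         loc_sq_integrable P (weighted_measure rho K Phi))
      \/
      [/\ uniformly_bounded_tv K,
          independent_kernel P K Phi
        & (\int[P]_w \int[tv (K w 0%R)]_x (enorm x ^+ d)%:E < +oo)%E]) :
  {ae P, forall w, locally_finite (abs_kernel_apply K Phi w)} /\
  loc_abs_sq_integrable P (kernel_apply K Phi).
Proof.
apply: (transport_conclusion htheta hP hPhi Phi_inv hK K_inv).
case: hab => [[rho hrho hW]|[hb hind hm]].
  exact: (mass_sq_log_dominating htheta hP hPhi Phi_inv hK K_inv hrho hd hW).
exact: (mass_sq_independent htheta hP hPhi Phi_inv hK K_inv Phi_sq hb hind hm).
Qed.
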